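(* Let $n\ge 4$, let $G=\mathrm{SL}_n(\mathbb{R})$, and let $H=\mathrm{SL}_2(\mathbb{R})<G$ be embedded naturally in the upper left corner. Then $G/H$ admits no compact quotients. The same is true if $\mathbb{R}$ is replaced by $\mathbb{C}$.
   Context: The natural embedding of $\mathrm{SL}_2$ in the upper left corner sends $A$ to the block-diagonal matrix $\mathrm{diag}(A,I_{n-2})$. A homogeneous space $G/H$ admits a compact quotient if there is a discrete subgroup $\Gamma<G$ which acts (by left translations) properly discontinuously on $G/H$ with a bounded (relatively compact) fundamental domain, i.e. with $\Gamma\backslash G/H$ compact. *)

(* Defs.v *)
From HB Require Import structures.
From mathcomp Require Import all_boot all_order all_algebra.
From mathcomp Require Import all_classical all_reals all_analysis.
From mathcomp Require Import complex.

Set Implicit Arguments.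
Unset Strict Implicit.
Unset Printing Implicit Defensive.

Import Order.TTheory GRing.Theory Num.Theory numFieldNormedType.Exports.

Local Open Scope classical_set_scope.
Local Open Scope ring_scope.

(* The library has groups and topological spaces but not their join. *)
HB.mixin Record Topological_Group_isTopGroup G & Topological G & Group G := {
  mulg_continuous : continuous (fun x : G * G => (x.1 * x.2)%g);
  invg_continuous : continuous (fun x : G => x^-1%g)
}.

#[short(type="topGroupType")]
HB.structure Definition TopGroup :=
  {G of Topological G & Group G & Topological_Group_isTopGroup G}.

Section HomogeneousSpace.
Local Open Scope group_scope.
Local Open Scope quotient_scope.
Variables (G : topGroupType) (H : set G).

Definition left_coset (g : G) : set G := [set g * h | h in H].

(* Comparing the cosets g H and g' H as sets makes this an equivalence relation
   for every H, so the quotient needs no proof that H is a subgroup. *)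
Definition coset_eq : rel G := fun g g' => left_coset g == left_coset g'.

Let coset_eq_refl : reflexive coset_eq.
Proof. by move=> g; exact: eqxx. Qed.
Let coset_eq_sym : symmetric coset_eq.
Proof. by move=> g g'; exact: eq_sym. Qed.
Let coset_eq_trans : transitive coset_eq.
Proof. by move=> g' g g'' /eqP; rewrite /coset_eq => ->. Qed.

Canonical coset_equiv :=
  EquivRel coset_eq coset_eq_refl coset_eq_sym coset_eq_trans.

(* G/H with the quotient topology *)
Definition homogeneous_space : Type := quotient_topology {eq_quot coset_equiv}.
HB.instance Definition _ := Topological.on homogeneous_space.
HB.instance Definition _ := Quotient.on homogeneous_space.

(* g . (aH) = (ga)H; see translate_pi for independence of the representative *)
Definition translate (g : G) (x : homogeneous_space) : homogeneous_space :=
  \pi_homogeneous_space (g * repr x).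

Lemma coset_piP (a b : G) :
  \pi_homogeneous_space a = \pi_homogeneous_space b <->
  left_coset a = left_coset b.
Proof.
by split=> [/(@eqmodP _ coset_equiv)/eqP|/eqP/(@eqmodP _ coset_equiv)].
Qed.

Lemma left_cosetM (g a b : G) :
  left_coset a = left_coset b -> left_coset (g * a) = left_coset (g * b).
Proof.
have lcM c : left_coset (g * c) = (fun x => g * x) @` left_coset c.
  rewrite /left_coset image_comp; apply: eq_imagel => h _ /=.
  by rewrite mulgA.
by rewrite !lcM => ->.
Qed.

Lemma translate_pi (g a : G) :
  translate g (\pi_homogeneous_space a) = \pi_homogeneous_space (g * a).
Proof. by apply/coset_piP/left_cosetM/coset_piP; rewrite reprK. Qed.

End HomogeneousSpace.

Section CompactQuotient.
Local Open Scope group_scope.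
Local Open Scope quotient_scope.
Variables (G : topGroupType) (H : set G) (Gamma : set G).
Implicit Types (x y : homogeneous_space H) (C : set (homogeneous_space H)).

Definition orbit_of x : set (homogeneous_space H) :=
  [set translate g x | g in Gamma].

Definition orbit_eq : rel (homogeneous_space H) :=
  fun x y => orbit_of x == orbit_of y.

Let orbit_eq_refl : reflexive orbit_eq.
Proof. by move=> x; exact: eqxx. Qed.
Let orbit_eq_sym : symmetric orbit_eq.
Proof. by move=> x y; exact: eq_sym. Qed.
Let orbit_eq_trans : transitive orbit_eq.
Proof. by move=> y x z /eqP; rewrite /orbit_eq => ->. Qed.

Canonical orbit_equiv :=
  EquivRel orbit_eq orbit_eq_refl orbit_eq_sym orbit_eq_trans.

(* Gamma \ G/H with the quotient topology *)
Definition orbit_space : Type := quotient_topology {eq_quot orbit_equiv}.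
HB.instance Definition _ := Topological.on orbit_space.
HB.instance Definition _ := Quotient.on orbit_space.

Definition properly_discontinuous : Prop :=
  forall C, compact C ->
    finite_set [set g | Gamma g /\ (translate g @` C) `&` C !=set0].

End CompactQuotient.

Definition discrete_subgroup (G : topGroupType) (Gamma : set G) : Prop :=
  group_closed [in Gamma] /\ isolated Gamma = Gamma.

Definition admits_compact_quotient (G : topGroupType) (H : set G) : Prop :=
  exists Gamma : set G,
    [/\ discrete_subgroup Gamma,
        properly_discontinuous H Gamma &
        compact [set: orbit_space H Gamma]].

Section SpecialLinear.
Variables (K : numFieldType) (n : nat).

Definition SL : Type := {A : 'M[K]_n | \det A == 1}.
HB.instance Definition _ := SubChoice.on SL.

(* the topology induced from the space of n x n matrices *)
Definition SL_topology := initial_topology (val : SL -> 'M[K]_n).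
HB.instance Definition _ := Topological.copy SL SL_topology.

Lemma SL_det (A : SL) : \det (val A) = 1.
Proof. exact/eqP/(valP A). Qed.

Lemma SL_unit (A : SL) : val A \in unitmx.
Proof. by rewrite unitmxE SL_det unitr1. Qed.

Lemma SL_one_subproof : \det (1%:M : 'M[K]_n) == 1.
Proof. by rewrite det1. Qed.
Definition SL_one : SL := Sub 1%:M SL_one_subproof.

Lemma SL_mul_subproof (A B : SL) : \det (val A *m val B) == 1.
Proof. by rewrite det_mulmx !SL_det mulr1. Qed.
Definition SL_mul (A B : SL) : SL := Sub (val A *m val B) (SL_mul_subproof A B).

Lemma SL_inv_subproof (A : SL) : \det (invmx (val A)) == 1.
Proof. by rewrite det_inv SL_det invr1. Qed.
Definition SL_inv (A : SL) : SL := Sub (invmx (val A)) (SL_inv_subproof A).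

Let SL_mulA : associative SL_mul.
Proof. by move=> A B C; apply: val_inj; rewrite /= mulmxA. Qed.
Let SL_mul1 : left_id SL_one SL_mul.
Proof. by move=> A; apply: val_inj; rewrite /= mul1mx. Qed.
Let SL_mulr1 : right_id SL_one SL_mul.
Proof. by move=> A; apply: val_inj; rewrite /= mulmx1. Qed.
Let SL_mulV : left_inverse SL_one SL_inv SL_mul.
Proof. by move=> A; apply: val_inj; rewrite /= mulVmx ?SL_unit. Qed.
Let SL_mulrV : right_inverse SL_one SL_inv SL_mul.
Proof. by move=> A; apply: val_inj; rewrite /= mulmxV ?SL_unit. Qed.

HB.instance Definition _ :=
  isGroup.Build SL SL_mulA SL_mul1 SL_mulr1 SL_mulV SL_mulrV.

Lemma continuous_mx (T : topologicalType) m p (f : T -> 'M[K]_(m, p)) :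
  (forall i j, continuous (fun x => f x i j)) -> continuous f.
Proof.
move=> fC x A [P nP sPA].
have : \forall y \near x, forall ij : 'I_m * 'I_p, P ij.1 ij.2 (f y ij.1 ij.2).
  apply: filter_forall => -[i j] /=; exact: (fC i j x).
by apply: filterS => y Hy /=; apply: sPA => i j; exact: (Hy (i, j)).
Qed.

Lemma continuous_det (T : topologicalType) m (f : T -> 'M[K]_m) :
  (forall i j, continuous (fun x => f x i j)) ->
  continuous (fun x => \det (f x)).
Proof.
move=> fC; apply: continuous_big => [|s _ x]; first exact: add_continuous.
apply: cvgMl_tmp; apply: continuous_big => [|k _]; first exact: mul_continuous.
exact: fC.
Qed.

Lemma SL_coord_continuous i j : continuous (fun A : SL => val A i j).
Proof.
move=> A; apply: (@continuous_comp _ _ _ (val : SL -> 'M[K]_n) (fun M => M i j)).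
  exact: (@initial_continuous _ _ (val : SL -> 'M[K]_n)).
exact: coord_continuous.
Qed.

Lemma continuous_SL (T : topologicalType) (f : T -> SL) :
  (forall i j, continuous (fun x => val (f x) i j)) -> continuous f.
Proof.
move=> fC; apply: (@continuous_comp_initial SL T _ val f).
exact: continuous_mx.
Qed.

Let SL_mulg_continuous : continuous (fun A : SL * SL => (A.1 * A.2)%g).
Proof.
apply: continuous_SL => i j.
under eq_fun do rewrite mxE.
apply: continuous_big => [|k _ A]; first exact: add_continuous.
apply: cvgM.
  exact: (continuous_comp cvg_fst (@SL_coord_continuous i k _)).
exact: (continuous_comp cvg_snd (@SL_coord_continuous k j _)).
Qed.

Let SL_invg_continuous : continuous (fun A : SL => A^-1%g).
Proof.
apply: continuous_SL => i j.
have -> : (fun A : SL => val A^-1%g i j) =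
    fun A => (-1) ^+ (j + i) * \det (row' j (col' i (val A))).
  by apply/funext => A; rewrite /= /invmx SL_unit SL_det invr1 scale1r mxE.
have minorC : continuous (fun A : SL => \det (row' j (col' i (val A)))).
  apply: continuous_det => k l; under eq_fun do rewrite !mxE.
  exact: SL_coord_continuous.
by move=> A; apply: cvgMl_tmp; [exact: nbhs_filter | exact: minorC].
Qed.

HB.instance Definition _ := Topological_Group_isTopGroup.Build SL
  SL_mulg_continuous SL_invg_continuous.

End SpecialLinear.

Section UpperLeft.
Variable K : numFieldType.

(* diag(A, I_(n-2)) for n >= 2, written entrywise to avoid a cast between
   'M_(2 + (n - 2)) and 'M_n; cf. upper_left_mx_block *)
Definition upper_left_mx (n : nat) (A : 'M[K]_2) : 'M[K]_n :=
  \matrix_(i, j)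
    if ((i < 2) && (j < 2))%N then A (inord i) (inord j) else (i == j)%:R.

Lemma upper_left_mx_block (m : nat) (A : 'M[K]_2) :
  upper_left_mx (2 + m) A = block_mx A 0 0 1%:M.
Proof.
apply/matrixP => i j; rewrite mxE.
case: (split_ordP i) => k ->; case: (split_ordP j) => l ->.
- rewrite block_mxEul /=.
  by congr (A _ _); apply: val_inj; rewrite /= inordK.
- by rewrite block_mxEur /= mxE eq_lrshift.
- by rewrite block_mxEdl /= mxE eq_rlshift.
- by rewrite block_mxEdr /= mxE eq_rshift.
Qed.

Definition SL2_upper_left (n : nat) : set (SL K n) :=
  [set g | exists A : SL K 2, val g = upper_left_mx n (val A)].

End UpperLeft.

(* Main.v *)
(** For a nonzero vector e the transvections 1 + e v with v e = 0 form a vector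
    group U_e of dimension n - 1 over K, and each of them is b h b^-1 with h in
    the upper left SL_2 = H and b bounded in terms of e.  Hence, if Gamma acts
    properly discontinuously on G/H, the number of elements of Gamma in x U_e C
    (C bounded) is bounded independently of x and e.  Cocompactness, on the other
    hand, puts an element of Gamma in x y H C for every y.  Let y run through a
    2(n-2)-parameter family of unipotent matrices and e through the projective
    space, and put d = dim_R K.  An element x^-1 gamma of size b lies in y H C
    for a proportion O(b^(-2d(n-2))) of the y, but in U_e C for at least a
    constant times b^(-d(n-1)) of the e.  Since 2(n-2) > n-1 for n >= 4, and
    since x can be chosen so that all the x^-1 gamma are large, double counting
    over Gamma gives a contradiction.  Proportions are taken in finite grids
    instead of with Lebesgue measure. *)

(* Pivoting in SL_2 writes every element of y H C as y l t C' with l and C' bounded and t =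
   diag(lam, lam^-1), so only t is unbounded and the size b is |lam| up to constants. With m = n -
   2, membership in a second set y' H C imposes 2m scalar conditions on y' of precision O(1/b); they
   are affine in the entries of y', which is why y' is taken as a product of two block unipotents.
   Membership in U_e C only asks that e, normalised, be O(1/b)-close to the vector y l (e_0 + lam^-1
   e_1), a condition on n - 1 coordinates. The order of the choices is forced. Cocompactness fixes
   the bound on C, which fixes the multiplicity M of the count over e, hence eps < 1/M, the size
   threshold and x. Only for this x does a finite list of gamma suffice for the bounded y, and only
   this list tells how fine the grids must be, since they have to resolve the scale 1/b for the
   largest b that occurs. A suitable x exists because H is unbounded. *)
Require Import Defs.
From mathcomp Require Import all_boot all_order perm all_algebra.
From mathcomp Require Import all_classical all_reals all_analysis.
From mathcomp Require Import complex ring lra zify.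

Set Implicit Arguments.
Unset Strict Implicit.
Unset Printing Implicit Defensive.

Import Order.TTheory GRing.Theory Num.Theory numFieldNormedType.Exports.

Local Open Scope classical_set_scope.
Local Open Scope ring_scope.

(** * Topology of double cosets *)

Section DoubleCosets.
Local Open Scope group_scope.
Local Open Scope quotient_scope.
Variables (G : topGroupType) (H Gamma : set G).
Hypothesis gH : group_closed [in H].
Hypothesis gGamma : group_closed [in Gamma].

Let inP (A : set G) x : (x \in [in A]) = (x \in A). Proof. by []. Qed.

Let pi1 (y : G) : homogeneous_space H := \pi_(homogeneous_space H) y.
Let pi2 (z : homogeneous_space H) : orbit_space H Gamma :=
  \pi_(orbit_space H Gamma) z.
Definition double_coset (y : G) := pi2 (pi1 y).

Lemma set_group1 (A : set G) : group_closed [in A] -> A 1.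
Proof. by case=> + _; rewrite inP inE. Qed.

Lemma set_groupM (A : set G) x y : group_closed [in A] -> A x -> A y ->
  A (x * y).
Proof.
move=> /group_closedM/(_ x y); rewrite !inP !inE; exact.
Qed.

Lemma set_groupV (A : set G) x : group_closed [in A] -> A x -> A x^-1.
Proof. move=> /group_closedV/(_ x); rewrite !inP !inE; exact. Qed.

Lemma pi_homogeneous_spaceP (x y : G) :
  pi1 x = pi1 y <-> exists2 h, H h & y = x * h.
Proof.
split=> [/coset_piP E|[h Hh ->]].
  have : left_coset H y y by exists 1; [exact: set_group1|rewrite mulg1].
  by rewrite -E => -[h Hh <-]; exists h.
apply/coset_piP/seteqP; split=> z [k Hk <-].
  exists (h^-1 * k); first by apply: set_groupM => //; exact: set_groupV.
  by rewrite mulgA mulgK.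
exists (h * k); first exact: set_groupM.
by rewrite mulgA.
Qed.

Lemma double_cosetP (x y : G) : double_coset x = double_coset y <->
  exists g h, [/\ Gamma g, H h & y = g * x * h].
Proof.
split=> [/(@eqmodP _ (orbit_equiv H Gamma))/eqP E|[g [h [Gg Hh ->]]]].
  have : orbit_of Gamma (pi1 y) (pi1 y).
    by exists 1; [exact: set_group1|rewrite /pi1 translate_pi mul1g].
  rewrite -E => -[g Gg]; rewrite /pi1 translate_pi.
  by move=> /pi_homogeneous_spaceP[h Hh ->]; exists g, h.
apply/(@eqmodP _ (orbit_equiv H Gamma))/eqP.
have -> : pi1 (g * x * h) = pi1 (g * x).
  by apply/esym/pi_homogeneous_spaceP; exists h.
rewrite /orbit_of; apply/seteqP; split=> z [k Gk <-].
  exists (k * g^-1); first by apply: set_groupM => //; exact: set_groupV.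
  by rewrite /pi1 !translate_pi mulgA mulgVK.
exists (k * g); first exact: set_groupM.
by rewrite /pi1 !translate_pi mulgA.
Qed.

Lemma translation_continuous (a b : G) : continuous (fun y => a * y * b).
Proof.
move=> y.
have mulC (f g : G -> G) : f z @[z --> y] --> f y -> g z @[z --> y] --> g y ->
    f z * g z @[z --> y] --> f y * g y.
  move=> fc gc.
  apply: (@continuous_comp _ _ _ (fun z => (f z, g z)) (fun p => p.1 * p.2)).
    exact: cvg_pair.
  exact: mulg_continuous.
apply: (mulC (fun z => a * z) (fun=> b)); last exact: cvg_cst.
by apply: (mulC (fun=> a) id); [exact: cvg_cst|exact: cvg_id].
Qed.

Lemma open_saturation (O : set G) : open O ->
  open [set y | exists g h, [/\ Gamma g, H h & O (g * y * h)]].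
Proof.
move=> Oo; rewrite openE => y [g [h [Gg Hh Oy]]].
have : \forall z \near y, O (g * z * h).
  by apply: translation_continuous; exact: open_nbhs_nbhs.
by apply: filterS => z Oz; exists g, h.
Qed.

(** The saturations Gamma (O k) H are open and increase to G, so their images form an increasing
    open cover of the compact double quotient, and one of them is everything. *)
Lemma cocompact_exhaustion (O : nat -> set G) :
  compact [set: orbit_space H Gamma] -> (forall k, open (O k)) ->
  {homo O : k l / (k <= l)%N >-> k `<=` l} -> (forall y, exists k, O k y) ->
  exists k, forall y, exists g h, [/\ Gamma g, H h & O k (g * y * h)].
Proof.
move=> /compact_near_coveringP cp Oo Omono Ocov.
pose V k := [set z | exists g y h, [/\ z = double_coset y, Gamma g, H h
  & O k (g * y * h)]].
have VE k y : V k (double_coset y) <-> exists g h, [/\ Gamma g, H h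
  & O k (g * y * h)].
  split=> [[g [y' [h [E Gg Hh Oy]]]]|[g [h [Gg Hh Oy]]]]; last by exists g, y,
    h.
  have /double_cosetP[g' [h' [Gg' Hh' E']]] := E.
  exists (g * g'), (h' * h); split; [exact: set_groupM|exact: set_groupM|].
  by rewrite !mulgA; move: Oy; rewrite E' !mulgA.
have Vo k : open (V k).
  (* [orbit_space] is a quotient of a quotient, so openness is unfolded twice to reach a subset of
     G. *)
  rewrite /open/= /quotient_open /open/= /quotient_open.
  rewrite (_ : _ @^-1` _ = [set y | exists g h, [/\ Gamma g, H h
    & O k (g * y * h)]]).
    exact: open_saturation.
  by apply/seteqP; split=> y => [Vy|?]; [exact/(VE k y)|apply/(VE k y)].
have := cp nat \oo V _ _.
case.
- move=> z _; have [y ->] : exists y, z = double_coset y.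
    by exists (repr (repr z)); rewrite /double_coset /pi1 /pi2 !reprK.
  have [k Oky] := Ocov y.
  exists (V k, [set l | (k <= l)%N]).
    split; last by exists k.
    apply: open_nbhs_nbhs; split; first exact: Vo.
    apply/VE; exists 1, 1; rewrite mul1g mulg1; split=> //; exact: set_group1.
  case=> z' l /= [[g [y' [h [-> Gg Hh Oy']]]] kl].
  by exists g, y', h; split=> //; apply: Omono Oy'.
- move=> k _ /(_ k (leqnn k)) Vk; exists k => y; apply/VE; exact: Vk.
Qed.

(** The relation g c = b h means that g sends the point cH to bH, both lying in the compact image of
    C in G/H. *)
Lemma properly_discontinuous_finite (C : set G) :
  properly_discontinuous H Gamma -> compact C ->
  finite_set [set g | Gamma g /\ exists b c h, [/\ C b, C c, H h
    & g * c = b * h]].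
Proof.
move=> pd Cc; have /pd : compact (pi1 @` C).
  by apply: continuous_compact => //; apply: continuous_subspaceT;
    exact: pi_continuous.
apply: sub_finite_set => g [Gg [b [c [h [Cb Cc' Hh E]]]]]; split=> //.
exists (pi1 b); split; last by exists b.
exists (pi1 c); first by exists c.
rewrite /pi1 translate_pi E; apply/esym/pi_homogeneous_spaceP; by exists h.
Qed.

End DoubleCosets.

(** * Absolute values on the ground field *)

(* A finite substitute for normalized Lebesgue measure on a ball of K: at scales
   above 1/N, a ball of radius r has proportion r^d up to the constant c. *)
Definition fine_grid (R : realType) (K : numFieldType) (nm : K -> R) (d : nat)
    (c N : R) (T : finType) (pt : T -> K) : Prop :=
  [/\ (0 < #|T|)%N, forall t, nm (pt t) <= 2 &
  forall a r, N^-1 <= r ->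
    #|[pred t | nm (pt t - a) <= r]|%:R <= (c * r) ^+ d * #|T|%:R :> R /\
    (nm a <= 1 -> r <= 1 -> (r / c) ^+ d * #|T|%:R <=
       #|[pred t | nm (pt t - a) <= r]|%:R :> R)].

(* absv_dim is the dimension of K over the reals. *)
Record absval (R : realType) (K : numFieldType) := AbsVal {
  absv :> K -> R;
  absv_ge0 : forall x, 0 <= absv x;
  absv_eq0 : forall x, absv x = 0 -> x = 0;
  absvM : forall x y, absv (x * y) = absv x * absv y;
  absvD : forall x y, absv (x + y) <= absv x + absv y;
  absv_nat : forall k, absv k%:R = k%:R;
  absv_open : forall r, open [set x : K | absv x < r];
  absv_compact : forall r, compact [set x : K | absv x <= r];
  absv_dim : nat;
  absv_dim_gt0 : (0 < absv_dim)%N;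
  absv_grid : exists2 c : R, 0 < c & forall N : R, 0 < N ->
    exists (T : finType) (pt : T -> K), fine_grid absv absv_dim c N pt
}.

Section AbsvalTheory.
Variables (R : realType) (K : numFieldType) (nm : absval R K).

Lemma absv0 : nm 0 = 0. Proof. exact: (absv_nat nm 0). Qed.

Lemma absv1 : nm 1 = 1. Proof. exact: (absv_nat nm 1). Qed.

Lemma absvN x : nm (- x) = nm x.
Proof.
have N1 : nm (-1) = 1.
  apply/eqP; rewrite -sqrp_eq1 ?absv_ge0// expr2 -absvM mulrNN mulr1.
  by rewrite absv1.
by rewrite -mulN1r absvM N1 mul1r.
Qed.

Lemma absv_gt0 x : x != 0 -> 0 < nm x.
Proof.
move=> x0; rewrite lt_neqAle absv_ge0 andbT eq_sym.
by apply: contra x0 => /eqP/absv_eq0->.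
Qed.

Lemma absv_neq0 x : 0 < nm x -> x != 0.
Proof. by apply: contraTneq => ->; rewrite absv0 ltxx. Qed.

Lemma absvV x : nm x^-1 = (nm x)^-1.
Proof.
have [->|x0] := eqVneq x 0; first by rewrite invr0 absv0 invr0.
have nx0 : nm x != 0 by rewrite gt_eqF// absv_gt0.
by apply: (mulfI nx0); rewrite -absvM !divff// absv1.
Qed.

Lemma absvB x y : nm (x - y) <= nm x + nm y.
Proof. by rewrite -(absvN y) absvD. Qed.

Lemma absvD_ge x y : nm x - nm y <= nm (x + y).
Proof. by rewrite lerBlDr -{1}(addrK y x) absvB. Qed.

Lemma absv_sum (I : Type) (s : seq I) (P : pred I) (F : I -> K) :
  nm (\sum_(i <- s | P i) F i) <= \sum_(i <- s | P i) nm (F i).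
Proof.
elim/big_rec2: _ => [|i a b _ le_ba]; first by rewrite absv0.
by rewrite (le_trans (absvD _ _ _))// lerD2l.
Qed.

Lemma absv_prod (I : Type) (s : seq I) (P : pred I) (F : I -> K) :
  nm (\prod_(i <- s | P i) F i) = \prod_(i <- s | P i) nm (F i).
Proof. by apply: big_morph; [exact: absvM|exact: absv1]. Qed.

Definition bnd p q (r : R) (A : 'M[K]_(p, q)) := forall i j, nm (A i j) <= r.

Lemma bnd_le p q r s (A : 'M[K]_(p, q)) : r <= s -> bnd r A -> bnd s A.
Proof. by move=> rs Ar i j; apply: le_trans rs. Qed.

Lemma bndD p q r s (A B : 'M[K]_(p, q)) :
  bnd r A -> bnd s B -> bnd (r + s) (A + B).
Proof. by move=> Ar Bs i j; rewrite mxE (le_trans (absvD _ _ _))// lerD. Qed.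

Lemma bndN p q r (A : 'M[K]_(p, q)) : bnd r A -> bnd r (- A).
Proof. by move=> Ar i j; rewrite mxE absvN. Qed.

Lemma bnd1 p : bnd 1 (1%:M : 'M[K]_p).
Proof. by move=> i j; rewrite mxE; case: (i == j); rewrite ?absv1 ?absv0. Qed.

Lemma bndM p q s a b (A : 'M[K]_(p, q)) (B : 'M[K]_(q, s)) :
  0 <= a -> bnd a A -> bnd b B -> bnd (q%:R * a * b) (A *m B).
Proof.
move=> a0 Aa Bb i j; rewrite mxE (le_trans (absv_sum _ _ _))//.
apply: (@le_trans _ _ (\sum_(k < q) a * b)).
  by apply: ler_sum => k _; rewrite absvM ler_pM ?absv_ge0.
by rewrite sumr_const card_ord -[leLHS]mulr_natl mulrA lexx.
Qed.

Lemma bnd_det p r (A : 'M[K]_p) : bnd r A -> nm (\det A) <= p`!%:R * r ^+ p.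
Proof.
move=> Ar; rewrite /determinant (le_trans (absv_sum _ _ _))//.
apply: (@le_trans _ _ (\sum_(s : 'S_p) r ^+ p)); last first.
  by rewrite sumr_const card_Sn mulr_natl.
apply: ler_sum => s _; rewrite absvM.
have -> : nm ((-1) ^+ s) = 1 by case: odd_perm; rewrite ?expr1 ?absvN absv1.
rewrite mul1r absv_prod -[X in _ <= r ^+ X](card_ord p) -prodr_const.
by apply: ler_prod => i _; rewrite absv_ge0 Ar.
Qed.

Lemma SL_invE p (g : SL K p) i j :
  val g^-1%g i j = (-1) ^+ (j + i) * \det (row' j (col' i (val g))).
Proof. by rewrite /= /invmx SL_unit SL_det invr1 scale1r mxE. Qed.

Definition sized p r (g : SL K p) := bnd r (val g) /\ bnd r (val g^-1%g).

(** For determinant 1 the inverse is the adjugate, whose entries are signed minors of size p - 1.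
    Adding the two bounds replaces taking their maximum. *)
Lemma bnd_sized p r (g : SL K p) :
  bnd r (val g) -> sized (r + p.-1`!%:R * r ^+ p.-1) g.
Proof.
move=> gr; have nx k : (0 : R) <= k%:R by rewrite ler0n.
have [p0|p0] := posnP p.
  by split=> i; exfalso; move: (ltn_ord i); rewrite {2}p0.
have r0 : 0 <= r by apply: le_trans (gr (Ordinal p0) (Ordinal p0));
  rewrite absv_ge0.
split; first by apply: bnd_le gr; rewrite lerDl mulr_ge0 ?exprn_ge0.
move=> i j; rewrite SL_invE absvM.
have -> : nm ((-1) ^+ (j + i)) = 1.
  by rewrite -signr_odd; case: odd; rewrite ?expr1 ?absvN absv1.
rewrite mul1r (le_trans (bnd_det (r := r) _)) ?lerDr//.
by move=> k l; rewrite !mxE.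
Qed.

Lemma sizedV p r (g : SL K p) : sized r g -> sized r g^-1%g.
Proof. by case=> ? ?; split=> //; rewrite invgK. Qed.

Lemma sized_le p r s (g : SL K p) : r <= s -> sized r g -> sized s g.
Proof. by move=> rs [? ?]; split; apply: bnd_le rs _. Qed.

Lemma sizedM p r s (g h : SL K p) : 0 <= r -> 0 <= s ->
  sized r g -> sized s h -> sized (p%:R * r * s) (g * h)%g.
Proof.
move=> r0 s0 [gr gr'] [hs hs']; split; first exact: bndM.
rewrite invgM mulrAC; exact: bndM.
Qed.

Lemma sized_ge0 p r (g : SL K p.+1) : sized r g -> 0 <= r.
Proof. by case=> /(_ 0 0) + _; apply: le_trans; rewrite absv_ge0. Qed.

Lemma open_bnd_lt p r : open [set g : SL K p |
  (forall i j, nm (val g i j) < r) /\ (forall i j, nm (val g^-1%g i j) < r)].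
Proof.
have main (f : SL K p -> SL K p) : continuous f ->
    open [set g | forall i j, nm (val (f g) i j) < r].
  move=> fc; rewrite openE => g gr.
  have : \forall h \near g, forall ij : 'I_p * 'I_p,
    nm (val (f h) ij.1 ij.2) < r.
    apply: (@filter_forall _ _ (fun ij => [set h :
      SL K p | nm (val (f h) ij.1 ij.2) < r]) (nbhs g) (nbhs_filter g)) => -[i
      j] /=.
    have cij : continuous (fun h => val (f h) i j).
      by move=> h; exact: (continuous_comp (fc h) (@SL_coord_continuous _ _ i j
        _)).
    apply: (cij g [set x | nm x < r]); apply: open_nbhs_nbhs.
    by split; [exact: absv_open|exact: gr].
  by apply: filterS => h hr i j; exact: (hr (i, j)).
apply: openI; [apply: (main id) => ?; exact: cvg_id|].
exact/(main (fun g => g^-1%g))/invg_continuous.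
Qed.

(** Bounded matrices form a compact set by Tychonoff, after flattening to row vectors, and the
    equation det = 1 is closed. *)
Lemma compact_bnd p r : compact [set g : SL K p | bnd r (val g)].
Proof.
have cM : compact [set A : 'M[K]_p | bnd r A].
  have -> : [set A : 'M[K]_p | bnd r A] =
      (@vec_mx K p p) @` [set v : 'rV[K]_(p * p)%N | forall i,
        nm (v ord0 i) <= r].
    apply/seteqP; split=> [A Ar|_ [f fr <-] i j]; last by rewrite mxE;
      exact: fr.
    exists (mxvec A); last by rewrite mxvecK.
    by move=> k; case/mxvec_indexP: k => i j; rewrite mxvecE; exact: Ar.
  apply: continuous_compact; last first.
    exact: (@rV_compact K (p * p)%N (fun=> [set x | nm x <=
      r]) (fun=> @absv_compact _ _ nm r)).
  apply: continuous_subspaceT; apply: continuous_mx => i j.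
  under eq_fun do rewrite mxE.
  exact: coord_continuous.
have cD : compact [set A : 'M[K]_p | \det A = 1 /\ bnd r A].
  rewrite (_ : mkset _ = [set A : 'M[K]_p | \det A =
    1] `&` [set A | bnd r A])//.
  rewrite setIC; apply: compact_closedI => //.
  apply: (@closed_comp _ _ (fun A : 'M[K]_p => \det A) [set 1]).
    move=> A _; apply: continuous_det => i j; exact: coord_continuous.
  apply: accessible_closed_set1; apply: hausdorff_accessible;
    exact: norm_hausdorff.
(* The filter is pushed forward along [val]. The topology of SL is initial for [val], so a cluster
   point of determinant 1 among matrices is a cluster point in SL. *)
move=> F FF Fr.
have [|A [[A1 Ar] clA]] := cD (val @ F) _.
  rewrite nbhs_simpl /=; apply: filterS Fr => g gr; split;
    [exact: SL_det|exact: gr].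
pose g : SL K p := Sub A (introT eqP A1).
exists g; split; first exact: Ar.
move=> B C FB [C' [[D oD <-] gD] DC].
have [_ [[h Bh <-] Dh]] : val @` B `&` D !=set0.
  apply: clA; first by rewrite nbhs_simpl /=; apply: filterS FB => h Bh;
    exists h.
  by apply: open_nbhs_nbhs; split.
by exists h; split=> //; exact: DC.
Qed.

End AbsvalTheory.

(** * Counting grid points in intervals *)

Lemma card_ord_itv_le n a k : (#|[pred i : 'I_n | (a <= i < a + k)%N]| <= k)%N.
Proof.
case: n => [|n]; first by rewrite (leq_trans (max_card _))// card_ord.
apply: (@leq_trans #|[seq (inord (a + j) : 'I_n.+1) | j : 'I_k]|); last first.
  by rewrite (leq_trans (leq_image_card _ _))// card_ord.
apply/subset_leq_card/fintype.subsetP => i; rewrite inE => /andP[ai ik].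
have jk : (i - a < k)%N by lia.
apply/mapP; exists (Ordinal jk); first by rewrite mem_enum.
by apply/val_inj; rewrite /= subnKC// inordK.
Qed.

Lemma card_ord_itv_ge n a k : (a + k <= n)%N ->
  (k <= #|[pred i : 'I_n | (a <= i < a + k)%N]|)%N.
Proof.
move=> akn; have lt (j : 'I_k) : (a + j < n)%N by have := ltn_ord j; lia.
have inj : injective (fun j => Ordinal (lt j)).
  by move=> j j' /(congr1 val)/= /addnI/val_inj.
rewrite -[X in (X <= _)%N]card_ord -(fintype.card_image inj).
apply/subset_leq_card/fintype.subsetP => _ /mapP[j _ ->].
by rewrite inE /= leq_addr ltn_add2l ltn_ord.
Qed.

Section Grid.
Variable R : realType.

(** The points are i/M - 1 for 0 <= i <= 2M with M > N, so M r >= 1 and rounding costs only a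
    constant factor. The constant 6 comes from the lower bound: if k is the integer part of M r,
    then r (2M + 1) <= 3 M r < 3 (k + 1) <= 6 k. *)
Lemma interval_grid (N : R) : 0 < N ->
  exists (T : finType) (pt : T -> R), [/\ (0 < #|T|)%N, forall t, `|pt t| <= 1 &
  forall a r, N^-1 <= r ->
    #|[pred t | `|pt t - a| <= r]|%:R <= 6 * r * #|T|%:R :> R
    /\ (`|a| <= 1 -> r <= 1 ->
        r / 6 * #|T|%:R <= #|[pred t | `|pt t - a| <= r]|%:R :> R)].
Proof.
move=> N0; pose m := (Num.truncn N).+1; pose M : R := m%:R.
have M0 : 0 < M by rewrite ltr0n.
have M1 : 1 <= M by rewrite ler1n.
have NM : N < M := truncnS_gt N.
pose pt (i : 'I_(m + m).+1) := (i%:R - M) / M.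
have ptE i a r : (`|pt i - a| <= r) = (M * (a + 1 - r) <= i%:R <= M * (a + 1 +
  r)).
  have -> : pt i - a = (i%:R - M * (a + 1)) / M.
    by rewrite /pt; field; rewrite gt_eqF.
  rewrite normrM normfV (gtr0_norm M0) ler_pdivrMr// ler_norml.
  by apply/idP/idP => /andP[? ?]; apply/andP; split; lra.
have MM : ((m + m).+1%:R : R) = 2 * M + 1 by rewrite -natr1 natrD -/M; ring.
exists 'I_(m + m).+1, pt; rewrite card_ord MM; split=> // [i|a r Nr].
  rewrite -[pt i]subr0 ptE; have := ltn_ord i; rewrite -(ltr_nat R) MM.
  have : 0 <= i%:R :> R by rewrite ler0n.
  have : i%:R <= 2 * M :> R.
    rewrite (_ : 2 * M = (m + m)%:R); last by rewrite natrD -/M; ring.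
    by rewrite ler_nat -ltnS ltn_ord.
  by move=> ? ? ?; apply/andP; split; lra.
have Mr : 1 <= M * r.
  by rewrite -(mulfV (lt0r_neq0 N0)); apply: ler_pM;
    rewrite ?invr_ge0 ?(ltW N0) ?(ltW NM).
split.
  (* Unless the ball is empty, all its indices lie in a window of length k starting at the smallest
     one, [i0]. *)
  set S := [pred t | _]; have [i iS|S0] := pickP S; last by rewrite eq_card0//;
    nra.
  case: (arg_minnP (fun i : 'I__ => i : nat) iS) => i0 i0S i0min.
  pose k := (Num.truncn (2 * M * r)).+1.
  have [k1 k2] : 2 * M * r < k%:R /\ k%:R <= 2 * M * r + 1.
    split; first exact: truncnS_gt.
    by rewrite /k -[leLHS]natr1 lerD2r truncn_le; nra.
  apply: (@le_trans _ _ k%:R); last nra.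
  rewrite ler_nat; apply: leq_trans (card_ord_itv_le _ i0 k).
  apply/subset_leq_card/fintype.subsetP => j jS; rewrite inE i0min//=.
  rewrite -(ltr_nat R) natrD.
  by move: jS i0S; rewrite !inE !ptE => /andP[? ?] /andP[? ?]; lra.
rewrite ler_norml => /andP[a1 a2] r1.
pose k := Num.truncn (M * r).
have [k1 k2] : k%:R <= M * r /\ M * r < k.+1%:R.
  by split; [rewrite truncn_le; lra|exact: truncnS_gt].
have k0 : (1 <= k)%N by rewrite truncn_ge_nat//; lra.
have k0' : 1 <= k%:R :> R by rewrite ler1n.
rewrite -natr1 in k2.
have Mr1 : M * r <= M by rewrite ger_pMr.
have Ma1 : - M <= M * a by rewrite -subr_ge0 opprK -{2}[M]mulr1 -mulrDr
  mulr_ge0 ?(ltW M0)//; lra.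
have Ma2 : M * a <= M by rewrite ger_pMr.
have r0 : 0 <= r by rewrite (le_trans _ Nr)// invr_ge0 ltW.
apply: (@le_trans _ _ k%:R).
  have : r <= M * r by rewrite ler_peMl.
  lra.
have a0 : 0 <= M * (a + 1) by lra.
pose e := Num.truncn (M * (a + 1)).
have [e1 e2] : e%:R <= M * (a + 1) /\ M * (a + 1) < e.+1%:R.
  by split; [rewrite truncn_le|exact: truncnS_gt].
rewrite -natr1 in e2.
rewrite ler_nat.
(* A ball may stick out of [-1, 1] on one side, so k consecutive indices are taken on the side of
   the centre facing 0: e + 1, ..., e + k here, and e + 1 - k, ..., e for a > 0. *)
have [a_le0|a_gt0] := lerP a 0.
  have Ma0 : M * a <= 0 by rewrite mulr_ge0_le0// ltW.
  have le : (e.+1 + k <= (m + m).+1)%N.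
    rewrite -(ler_nat R) MM natrD -natr1.
    suff : e%:R + k%:R <= 2 * M by lra.
    lra.
  apply: leq_trans (card_ord_itv_ge le) _.
  apply/subset_leq_card/fintype.subsetP => i; rewrite !inE ptE => /andP[].
  rewrite -!(ler_nat R) natrD -!natr1 => ? ?; apply/andP; split; lra.
have Ma0 : 0 < M * a by rewrite mulr_gt0.
have ke : (k <= e)%N by rewrite truncn_ge_nat//; lra.
have le : (e.+1 - k + k <= (m + m).+1)%N.
  rewrite subnK; last exact: leqW.
  rewrite -(ler_nat R) MM -natr1; lra.
apply: leq_trans (card_ord_itv_ge le) _.
apply/subset_leq_card/fintype.subsetP => i; rewrite !inE ptE subnK;
  last exact: leqW.
rewrite -!(ler_nat R) natrB; last exact: leqW.
rewrite -!natr1 => /andP[? ?]; apply/andP; split; lra.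
Qed.

End Grid.

(** * The absolute values of the real and the complex numbers *)

Section Instances.
Variable R : realType.

Definition real_absval : absval R R.
Proof.
apply: (@AbsVal R R Num.norm _ _ _ _ _ _ _ 1%N) => //.
- exact: normr0_eq0.
- exact: normrM.
- exact: ler_normD.
- exact: normr_nat.
- move=> r; rewrite (_ : mkset _ = ball (0 : R) r); first exact: ball_open.
  by apply/seteqP; split=> x; rewrite /ball/= sub0r normrN.
- move=> r; rewrite (_ : mkset _ = [set` `[- r, r]]);
  first exact: segment_compact.
  by apply/seteqP; split=> x /=; rewrite in_itv/= ler_norml.
- exists 6 => // N /interval_grid[T [pt [T0 pt1 H]]].
  exists T, pt; split=> //; first by move=> t;
    rewrite (le_trans (pt1 t))// ler1n.
Defined.

Import Normc.
Local Open Scope complex_scope.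
Let C : numFieldType := R[i].

Lemma normc_norm (z : C) : `|z| = (normc z)%:C. Proof. by case: z. Qed.

Lemma normc_ge0 (z : C) : 0 <= normc z.
Proof. by rewrite -lecR -normc_norm normr_ge0. Qed.

Lemma normcD (x y : C) : normc (x + y) <= normc x + normc y.
Proof. exact: le_normcD. Qed.

Lemma normcB (x y : C) : normc (x - y) = normc (y - x).
Proof. by apply: (@complexI R); rewrite -!normc_norm distrC. Qed.

Lemma normc_nat k : normc (k%:R : C) = k%:R.
Proof.
by apply: (@complexI R); rewrite -normc_norm normr_nat rmorph_nat.
Qed.

Lemma normc_leD (a b : R) : normc (a +i* b : C) <= `|a| + `|b|.
Proof.
rewrite /= -(@ler_pXn2r _ 2) ?nnegrE ?sqrtr_ge0 ?addr_ge0// sqr_sqrtr ?addr_ge0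
  ?sqr_ge0//.
have := normr_ge0 a; have := normr_ge0 b.
rewrite -(real_normK (num_real a)) -(real_normK (num_real b)); nra.
Qed.

Lemma normc_ge_absRe (a b : R) : `|a| <= normc (a +i* b : C).
Proof.
by rewrite -lecR -normc_norm; exact: (normc_ge_Re (a +i* b)).
Qed.

Lemma normc_ge_absIm (a b : R) : `|b| <= normc (a +i* b : C).
Proof.
rewrite /= -(@ler_pXn2r _ 2) ?nnegrE ?sqrtr_ge0// sqr_sqrtr ?addr_ge0
  ?sqr_ge0//.
by rewrite (real_normK (num_real b)) lerDr sqr_ge0.
Qed.

Lemma nbhs_normc (z : C) (e : R) : 0 < e -> \forall w \near z,
  normc (z - w) < e.
Proof.
move=> e0; apply/nbhs_ballP; exists e%:C => /=; first by rewrite ltcR.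
by move=> w; rewrite /ball/= normc_norm ltcR.
Qed.

Lemma continuous_pair_complex : continuous (fun p : R * R => p.1 +i* p.2 : C).
Proof.
move=> p A /nbhs_ballP[e /= e0 eA].
have [e' e'0 ee'] : exists2 e' : R, 0 < e' & e = e'%:C.
  case: e e0 {eA} => a b; rewrite ltcE /= => /andP[/eqP-> a0].
  by exists a.
have e2 : 0 < e' / 2 by rewrite divr_gt0.
exists (ball p.1 (e' / 2), ball p.2 (e' / 2)).
  by split; exact: nbhsx_ballx.
case=> q1 q2 [/= h1 h2]; apply: eA; rewrite /ball/= normc_norm ee' ltcR.
have -> : (p.1 +i* p.2 : C) - (q1 +i* q2) = (p.1 - q1) +i* (p.2 - q2) by [].
rewrite (le_lt_trans (normc_leD _ _))//.
by move: h1 h2; rewrite /ball/=; lra.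
Qed.

Definition complex_absval : absval R C.
Proof.
apply: (@AbsVal R C (@normc R) _ _ _ _ _ _ _ 2%N) => //.
- exact: normc_ge0.
- exact: eq0_normc.
- exact: normcM.
- exact: normcD.
- exact: normc_nat.
- move=> r; rewrite openE => z zr.
  have := @nbhs_normc z (r - normc z); rewrite subr_gt0 => /(_ zr).
  apply: filterS => w /= zw; rewrite -(subrK z w).
  by rewrite (le_lt_trans (normcD _ _))// normcB -ltrBrDr.
- move=> r; pose f (p : R * R) : C := p.1 +i* p.2.
  rewrite (_ : mkset _ = f @` ([set` `[- r, r]] `*` [set` `[- r,
    r]]) `&` [set z | normc z <= r]).
    apply: compact_closedI.
      apply: continuous_compact; last by apply: compact_setX;
        exact: segment_compact.
      by apply: continuous_subspaceT; exact: continuous_pair_complex.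
    rewrite -[X in closed X]setCK; apply: open_closedC;
      rewrite openE => z /= /negP.
    rewrite -ltNge => zr; have := @nbhs_normc z (normc z - r);
      rewrite subr_gt0 => /(_ zr).
    apply: filterS => w zw; apply/negP; rewrite -ltNge.
    have := normcD (z - w) w; rewrite subrK; lra.
  apply/seteqP; split=> [[a b] abr|z []//]; split=> //; exists (a, b) => //.
  split; rewrite /= in_itv/= -ler_norml.
    exact: le_trans (normc_ge_absRe a b) abr.
  exact: le_trans (normc_ge_absIm a b) abr.
(* A disc of radius r lies in the square of half-side r and contains the one of half-side r / 2. The
   halving turns 6 into 12 and requires the interval grid at scale 1 / (2N). *)
- exists 12 => // N N0.
  have [|T [pt [T0 pt1 H]]] := @interval_grid R (2 * N);
    first by rewrite mulr_gt0.
  exists (T * T)%type, (fun t => pt t.1 +i* pt t.2); split.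
  + by rewrite card_prod muln_gt0 T0.
  + move=> t; rewrite (le_trans (normc_leD _ _))//.
    by rewrite (_ : 2 = 1 + 1)// lerD.
  + move=> [a b] r Nr.
    have N'0 : 0 < N^-1 by rewrite invr_gt0.
    have Nr2 : (2 * N)^-1 <= r / 2 by rewrite invfM mulrC ler_pM2r.
    have Nr1 : (2 * N)^-1 <= r by apply: le_trans Nr2 _; lra.
    have cardX s : (#|[pred t | (`|pt t - a| <= s)%R]| *
      #|[pred t | (`|pt t - b| <= s)%R]|)%N
        = #|[pred t : T * T | (`|pt t.1 - a| <= s) && (`|pt t.2 - b| <= s)]|.
      by rewrite -cardX; apply: eq_card => -[? ?]; rewrite !inE.
    have nmE t : (pt t.1 +i* pt t.2 : C) - (a +i* b) = (pt t.1 - a) +i*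
      (pt t.2 - b) by [].
    have [Ha1 Ha2] := H a r Nr1; have [Hb1 Hb2] := H b r Nr1.
    have [_ Ha3] := H a _ Nr2; have [_ Hb3] := H b _ Nr2.
    rewrite card_prod natrM; split.
      apply: (@le_trans _ _ (6 * r * #|T|%:R * (6 * r * #|T|%:R))).
        apply: (@le_trans _ _ (#|[pred t : T * T | (`|pt t.1 - a| <=
          r) && (`|pt t.2 - b| <= r)]|%:R)).
          rewrite ler_nat; apply/subset_leq_card/fintype.subsetP => t.
          rewrite !inE nmE => tr; apply/andP; split.
            exact: le_trans (normc_ge_absRe _ (pt t.2 - b)) tr.
          exact: le_trans (normc_ge_absIm (pt t.1 - a) _) tr.
        by rewrite -cardX natrM ler_pM.
      have rT : 0 <= r * #|T|%:R by rewrite mulr_ge0// (le_trans _ Nr)//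
        invr_ge0 ltW.
      rewrite [leRHS](_ : _ = 144 * (r * #|T|%:R) ^+ 2); last by ring.
      rewrite [leLHS](_ : _ = 36 * (r * #|T|%:R) ^+ 2); last by ring.
      by rewrite ler_wpM2r ?sqr_ge0// ler_nat.
    move=> ab1 r1; have r21 : r / 2 <= 1 by rewrite ler_pdivrMr//; lra.
    have r0 : 0 <= r by rewrite (le_trans _ Nr)// invr_ge0 ltW.
    apply: (@le_trans _ _ (#|[pred t : T * T | (`|pt t.1 - a| <=
      r / 2) && (`|pt t.2 - b| <= r / 2)]|%:R)).
      rewrite -cardX natrM [leLHS](_ : _ = (r / 2 / 6 * #|T|%:R) * (r / 2 / 6 *
        #|T|%:R)).
        apply: ler_pM.
        - by rewrite mulr_ge0// !divr_ge0.
        - by rewrite mulr_ge0// !divr_ge0.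
        - by apply: Ha3 => //; exact: le_trans (normc_ge_absRe a b) ab1.
        - by apply: Hb3 => //; exact: le_trans (normc_ge_absIm a b) ab1.
      by field.
    rewrite ler_nat; apply/subset_leq_card/fintype.subsetP => t.
    rewrite !inE nmE => /andP[? ?]; apply: le_trans (normc_leD _ _) _.
    by rewrite (_ : r = r / 2 + r / 2) ?lerD// -splitr.
Defined.

End Instances.

(** * Transvections *)

(** This is det (1 + e v) = 1 + v e for v e = 0. The bordered matrix M factors as lower times upper,
    with Schur complement 1 + e v, and as upper times lower, with complement 1 - v (- e) evaluated
    at v e = 0. *)
Lemma det_transvection (F : comNzRingType) n (e : 'cV[F]_n) (v : 'rV[F]_n) :
  v *m e = 0 -> \det (1%:M + e *m v) = 1.
Proof.
move=> ve0; pose M : 'M[F]_(1 + n) := block_mx 1%:M (- v) e 1%:M.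
have M1 : M = block_mx 1%:M 0 e 1%:M *m block_mx 1%:M (- v) 0 (1%:M + e *m v).
  rewrite mulmx_block !mulmx1 !mul1mx !mul0mx ?mulmx0 !addr0 mulmxN.
  by rewrite addrCA addNr addr0.
have M2 : M = block_mx 1%:M (- v) 0 1%:M *m block_mx 1%:M 0 e 1%:M.
  rewrite mulmx_block !mulmx1 !mul1mx !mul0mx ?mulmx0 !add0r mulNmx ve0 oppr0.
  by rewrite addr0.
have : \det M = \det M by [].
by rewrite {1}M1 M2 !det_mulmx !det_lblock !det_ublock !det1 !mul1r.
Qed.

Section Transvections.
Variables (R : realType) (K : numFieldType) (nm : absval R K).

Section AnyDim.
Variable n : nat.
Local Notation G := (SL K n).
Implicit Types (e : 'cV[K]_n) (v : 'rV[K]_n) (u b : G).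

Definition is_transvection e u :=
  exists2 v, v *m e = 0 & val u = 1%:M + e *m v.

Lemma transvection_exists e v : v *m e = 0 ->
  exists2 u : G, val u = 1%:M + e *m v & val u^-1%g = 1%:M - e *m v.
Proof.
move=> ve0; have d1 : \det (1%:M + e *m v) == 1 by rewrite det_transvection.
have d2 : \det (1%:M + e *m (- v)) == 1.
  by rewrite det_transvection// mulNmx ve0 oppr0.
pose u : G := Sub (1%:M + e *m v) d1; pose u' : G := Sub (1%:M + e *m (- v)) d2.
exists u => //; have -> : (u^-1)%g = u'.
  apply: (mulgI u); rewrite mulgV; apply/val_inj => /=.
  rewrite mulmxN mulmxDr mulmx1 mulmxN mulmxDl mul1mx -mulmxA (mulmxA v) ve0.
  by rewrite mul0mx mulmx0 addr0 addrK.
by rewrite /= mulmxN.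
Qed.

Lemma is_transvectionVM e u u' : is_transvection e u -> is_transvection e u' ->
  is_transvection e (u^-1 * u')%g.
Proof.
case=> v ve0 uE [v' ve0' uE'].
exists (v' - v); first by rewrite mulmxBl ve0 ve0' subrr.
have [w wE wE'] := transvection_exists ve0.
have -> : u = w by apply: val_inj; rewrite uE wE.
transitivity (val w^-1%g *m val u') => //.
rewrite mulmxBr wE' uE' mulmxDl mul1mx mulNmx -mulmxA mulmxDr mulmx1.
by rewrite (mulmxA v) ve0 mul0mx addr0 addrA.
Qed.

Lemma is_transvectionJ b e u : is_transvection e u ->
  is_transvection (val b *m e) (b * u * b^-1)%g.
Proof.
case=> v ve0 uE; exists (v *m val b^-1%g).
  by rewrite mulmxA -(mulmxA v) [_ *m val b]mulVmx ?SL_unit// mulmx1.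
transitivity (val b *m val u *m val b^-1%g) => //.
rewrite uE mulmxDr mulmx1 mulmxDl [val b *m val b^-1%g]mulmxV ?SL_unit//.
by rewrite !mulmxA.
Qed.

Lemma bnd_transvection r s e v : 0 <= r -> bnd nm r e -> bnd nm s v ->
  bnd nm (1 + r * s) (1%:M + e *m v) /\ bnd nm (1 + r * s) (1%:M - e *m v).
Proof.
move=> r0 er vs.
have b1 := @bnd1 _ _ nm n.
have b2 : bnd nm (r * s) (e *m v) by rewrite -[r]mul1r; exact: bndM.
by split; apply: bndD => //; exact: bndN.
Qed.

End AnyDim.
End Transvections.

(** * H as the image of a block-diagonal homomorphism from SL_2 *)

Section UpperLeftGroup.
Variables (K : numFieldType) (m : nat).
Local Notation n := (2 + m)%N.

Lemma SL2_upper_leftP (A : SL K 2) : exists h : SL K n,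
  val h = block_mx (val A) 0 0 1%:M /\ val h^-1%g =
    block_mx (val A^-1%g) 0 0 1%:M.
Proof.
have d (B : SL K 2) : \det (block_mx (val B) 0 0 (1%:M : 'M[K]_m)) == 1.
  by rewrite det_ublock det1 mulr1 SL_det.
pose h B : SL K n := Sub (block_mx (val B) 0 0 (1%:M : 'M[K]_m)) (d B).
exists (h A); split=> //; have -> : ((h A)^-1)%g = h A^-1%g; last by [].
apply: (mulgI (h A)); rewrite mulgV; apply/val_inj => /=.
rewrite mulmx_block !mulmx0 !mul0mx !mulmx1 !addr0 add0r.
by rewrite mulmxV ?SL_unit// -scalar_mx_block.
Qed.

Definition upper_left (A : SL K 2) : SL K n := projT1 (cid (SL2_upper_leftP A)).

Lemma val_upper_left A : val (upper_left A) = block_mx (val A) 0 0 1%:M.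
Proof. by rewrite /upper_left; case: cid => h []. Qed.

Lemma upper_leftV A : ((upper_left A)^-1)%g = upper_left A^-1%g.
Proof.
by apply: val_inj; rewrite val_upper_left {1}/upper_left; case: cid => h [].
Qed.

Lemma upper_leftM A B : upper_left (A * B)%g = (upper_left A * upper_left B)%g.
Proof.
apply: val_inj; rewrite val_upper_left /= !val_upper_left mulmx_block.
by rewrite !mulmx0 !mul0mx !mulmx1 !addr0 add0r.
Qed.

Lemma upper_left1 : upper_left 1%g = 1%g.
Proof. by apply: (mulgI (upper_left 1%g)); rewrite -upper_leftM !mulg1. Qed.

Lemma SL2_upper_leftE (h : SL K n) :
  @SL2_upper_left K n h <-> exists A, h = upper_left A.
Proof.
split=> [[A hA]|[A ->]]; exists A; last first.
  by rewrite upper_left_mx_block val_upper_left.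
by apply: val_inj; rewrite hA upper_left_mx_block val_upper_left.
Qed.

Lemma group_closed_SL2_upper_left : group_closed [in @SL2_upper_left K n].
Proof.
have inP (x : SL K n) : (x \in [in @SL2_upper_left K n]) =
  (x \in @SL2_upper_left K n) by [].
split; first by rewrite inP inE; apply/SL2_upper_leftE; exists 1%g;
  rewrite upper_left1.
move=> x y; rewrite !inP !inE => /SL2_upper_leftE[A ->] /SL2_upper_leftE[B ->].
by apply/SL2_upper_leftE; exists (A * B^-1)%g; rewrite upper_leftM upper_leftV.
Qed.

End UpperLeftGroup.

(** * Transvections conjugate into H by bounded elements *)

Section Thin.
Variables (R : realType) (K : numFieldType) (nm : absval R K) (m : nat).
Local Notation n := (2 + m)%N.
Local Notation G := (SL K n).
Local Notation H := (@SL2_upper_left K n).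

Lemma bnd_delta p q (i : 'I_p) (j : 'I_q) : bnd nm 1 (delta_mx i j).
Proof. by move=> k l; rewrite mxE; case: (_ && _); rewrite ?absv1 ?absv0. Qed.

Lemma sized_upper_left r (A : SL K 2) : 1 <= r -> sized nm r A ->
  sized nm r (upper_left m A).
Proof.
move=> r1 [Ar Ar'].
have main (M : 'M[K]_2) : bnd nm r M -> bnd nm r (block_mx M 0 0 (1%:M :
  'M[K]_m)).
  move=> Mr i j; case: (split_ordP i) => k ->; case: (split_ordP j) => l ->.
  - by rewrite block_mxEul.
  - by rewrite block_mxEur mxE absv0 (le_trans _ r1).
  - by rewrite block_mxEdl mxE absv0 (le_trans _ r1).
  - rewrite block_mxEdr mxE; case: (k == l); rewrite ?absv1 ?absv0//.
    exact: le_trans r1.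
by split; rewrite ?upper_leftV val_upper_left; exact: main.
Qed.

(** Such a u fixes the point bH of G/H with b bounded, although u itself may be arbitrarily large;
    this is what proper discontinuity can see. *)
Definition thin r (u : G) := exists b h, [/\ sized nm r b, H h
  & u = (b * h * b^-1)%g].

Lemma thinJ r s (b u : G) : 0 <= s -> sized nm s b ->
  thin r (b^-1 * u * b)%g -> thin (n%:R * s * r) u.
Proof.
move=> s0 bs [c [h [cr Hh E]]]; exists (b * c)%g, h; split=> //.
  by apply: sizedM => //; exact: sized_ge0 cr.
transitivity (b * (c * h * c^-1) * b^-1)%g; last by rewrite invgM !mulgA.
by rewrite -E !mulgA mulgV mul1g mulgK.
Qed.

Let i0 : 'I_n := lshift m 0.
Let i1 : 'I_n := lshift m 1.

Lemma elementary_transvection (c : K) (u : G) :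
  val u = 1%:M + delta_mx i0 0 *m (c *: delta_mx 0 i1 : 'rV[K]_n) -> H u.
Proof.
move=> uE.
have ve0 : (c *: delta_mx 0 1 : 'rV[K]_2) *m (delta_mx 0 0 : 'cV[K]_2) = 0.
  by rewrite -scalemxAl mul_delta_mx_0 ?scaler0.
have [A AE _] := transvection_exists ve0.
apply/SL2_upper_leftE; exists A; apply: val_inj.
rewrite val_upper_left uE AE -!scalemxAr !mul_delta_mx.
apply/matrixP => i j; case: (split_ordP i) => k ->;
  case: (split_ordP j) => l ->.
- by rewrite block_mxEul !mxE !(inj_eq (@lshift_inj _ _)).
- by rewrite block_mxEur !mxE !eq_lrshift ?andbF ?mulr0 ?addr0 // eq_sym
  eq_lrshift andbF mulr0 addr0.
- by rewrite block_mxEdl !mxE !eq_rlshift ?mulr0 ?addr0.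
- by rewrite block_mxEdr !mxE !(inj_eq (@rshift_inj _ _)) !eq_rlshift ?mulr0
  ?addr0.
Qed.

Lemma row_mul_delta (v : 'rV[K]_n) i : v *m delta_mx i (0 : 'I_1) = (v 0 i)%:M.
Proof. by rewrite -colE; apply/matrixP => a b; rewrite !mxE !ord1 mulr1n. Qed.

(** For u = 1 + e_0 v, the conjugate b^-1 u b equals 1 + (b^-1 e_0)(v b). It lies in H as soon as b
    fixes e_0 and v b = c e_1^T. Only the ratios v_j / c enter b, so the bound does not depend on
    the size of v. *)
Lemma first_transvection_thin u :
  is_transvection (delta_mx i0 0) u -> thin (n%:R * 2 * 3) u.
Proof.
case=> v ve0 uE.
have v0 : v 0 i0 = 0.
  by move/matrixP: ve0 => /(_ 0 0); rewrite row_mul_delta !mxE eqxx mulr1n.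
have i10 : i1 != i0 by [].
case: (@Order.TotalTheory.arg_maxP _ _ _ i1 (fun i => i !=
  i0) (fun i => nm (v 0 i)) i10).
move=> l l0 lmax; have [vl0|vl0] := eqVneq (nm (v 0 l)) 0.
  have -> : u = 1%g.
    apply: val_inj; rewrite uE (_ : v = 0) ?mulmx0 ?addr0//.
    apply/rowP => j; rewrite mxE; have [->//|j0] := eqVneq j i0.
    apply: (@absv_eq0 _ _ nm); apply/eqP; rewrite eq_le absv_ge0 andbT -vl0.
    exact: lmax.
  exists 1%g, 1%g; split; last by rewrite invg1 !mulg1.
    have b1 := @bnd1 _ _ nm n.
    have n1 : 1 <= (n%:R : R) by rewrite ler1n.
    apply: (@sized_le _ _ _ _ 1); first by move: n1; set x := (n%:R : R) => n1;
      nra.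
    by split; rewrite ?invg1.
  by apply/SL2_upper_leftE; exists 1%g; rewrite upper_left1.
have {}vl0 : 0 < nm (v 0 l) by rewrite lt_neqAle eq_sym vl0 absv_ge0.
(* A shear makes v_1 comparable to the largest coordinate of v. *)
have [t [t1 tl vl]] : exists t : K, [/\ nm t <= 1, t *+ (i1 == l) = 0 &
    nm (v 0 l) <= 2 * nm (v 0 i1 + t * v 0 l)].
  have [le|lt] := lerP (nm (v 0 l)) (2 * nm (v 0 i1)).
    by exists 0; rewrite absv0 mul0rn mul0r addr0.
  exists 1; rewrite absv1 mul1r; split=> //.
    by case: eqVneq => // E; exfalso; move: lt; rewrite E;
      have := absv_ge0 nm (v 0 l); lra.
  have := absvD_ge nm (v 0 l) (v 0 i1); rewrite (addrC (v 0 l)); lra.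
have w0 : 0 < nm (v 0 i1 + t * v 0 l) by lra.
set c := v 0 i1 + t * v 0 l in vl w0.
have c0 := absv_neq0 w0.
(* If l = i1, the product would be t; then [tl] gives t = 0. *)
have te : (delta_mx 0 i1 : 'rV[K]_n) *m (t *: delta_mx l 0 : 'cV[K]_n) = 0.
  by rewrite -scalemxAr mul_delta_mx_cond -scaler_nat scalerA mulr_natr tl
    scale0r.
have [b3 b3E b3VE] := transvection_exists te.
(* A second one then turns v into c e_1^T. *)
pose w : 'rV[K]_n := c^-1 *: (v + (t * v 0 l) *: delta_mx 0 i1) - delta_mx 0 i1.
have wE j : w 0 j = if j == i1 then 0 else c^-1 * v 0 j.
  rewrite !mxE /=; case: eqVneq => [->|_].
    by rewrite mulr1 mulVf// subrr.
  by rewrite mulr0 addr0 subr0.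
have we : (- w) *m (delta_mx i1 0 : 'cV[K]_n) = 0.
  by rewrite row_mul_delta mxE wE eqxx oppr0; apply/matrixP => ? ?;
    rewrite !mxE mul0rn.
have [b4 b4E b4VE] := transvection_exists we.
have b3E' : v *m val b3 = c *: (w + delta_mx 0 i1).
  rewrite b3E mulmxDr mulmx1 mulmxA -scalemxAr row_mul_delta -scalemxAl.
  by rewrite mul_scalar_mx scalerA subrK scalerA divff// scale1r.
have vE : v *m val (b3 * b4)%g = c *: delta_mx 0 i1.
  transitivity (v *m val b3 *m val b4); first by rewrite -mulmxA.
  rewrite b3E' -scalemxAl b4E mulmxDr mulmx1 mulmxA mulmxDl mul_delta_mx.
  rewrite -[w in w *m delta_mx _ _]opprK mulNmx we oppr0 add0r.
  rewrite (_ : delta_mx 0 0 = 1%:M) ?mul1mx; last first.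
    by apply/matrixP => i j; rewrite !ord1 !mxE.
  by rewrite addrAC subrr add0r.
have d3E : val b3^-1%g *m (delta_mx i0 0 : 'cV[K]_n) = delta_mx i0 0.
  by rewrite b3VE mulmxBl mul1mx -mulmxA mul_delta_mx_0// mulmx0 subr0.
have dE : val (b3 * b4)^-1%g *m (delta_mx i0 0 : 'cV[K]_n) = delta_mx i0 0.
  rewrite invgM; transitivity (val b4^-1%g *m (val b3^-1%g *m (delta_mx i0 0 :
    'cV[K]_n))).
    by rewrite mulmxA.
  have wi0 : w 0 i0 = 0 by rewrite wE /= v0; exact: mulr0.
  rewrite d3E b4VE mulmxN opprK mulmxDl mul1mx -mulmxA row_mul_delta wi0.
  by rewrite raddf0 mulmx0 addr0.
(* The shear has |t| <= 1, hence the bound 1 + 1. The entries of w are at most 2 because |v_j| <=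
   |v_l| <= 2 |c|, hence the bound 1 + 2. *)
have b34 : sized nm (n%:R * 2 * 3) (b3 * b4)%g.
  apply: sizedM => //.
    rewrite /sized b3E b3VE (_ : 2 = 1 + 1 * 1); last by rewrite mulr1.
    apply: bnd_transvection => //; last exact: bnd_delta.
    move=> i j; rewrite !mxE absvM -[leRHS]mulr1 ler_pM ?absv_ge0//.
    by case: (_ && _); rewrite ?absv1 ?absv0.
  rewrite /sized b4E b4VE (_ : 3 = 1 + 1 * 2); last by lra.
  apply: bnd_transvection => //; first exact: bnd_delta.
  apply: bndN => i j; rewrite ord1 wE; case: eqVneq => [_|_];
    first by rewrite absv0.
  rewrite absvM absvV mulrC ler_pdivrMr// (le_trans _ vl)//.
  have [->|j0] := eqVneq j i0; first by rewrite v0 absv0 absv_ge0.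
  exact: lmax.
move: (b3 * b4)%g vE dE b34 => b vE dE b34.
exists b, (b^-1 * u * b)%g; split=> //.
  apply: (@elementary_transvection c).
  transitivity (val b^-1%g *m val u *m val b) => //.
  rewrite uE mulmxDr mulmx1 mulmxDl mulVmx ?SL_unit// mulmxA dE -mulmxA vE.
  by rewrite -scalemxAr.
by rewrite !mulgA mulgV mul1g mulgK.
Qed.

(** If e_0 = 1, the matrix 1 + (e - e_0) e_0^T (with the basis vector e_0 inside) is a bounded
    transvection carrying the basis vector to e, so conjugation reduces to
    [first_transvection_thin]. *)
Lemma transvection_thin r : exists r', forall (k : 'I_2) (e : 'cV[K]_n) u,
  e (lshift m k) 0 = 1 -> bnd nm r e -> is_transvection e u -> thin r' u.
Proof.
pose r1 := n%:R * (1 + (r + 1) * 1) * (n%:R * 2 * 3) : R.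
have main (e : 'cV[K]_n) (u : G) : e i0 0 = 1 -> bnd nm r e ->
  is_transvection e u -> thin r1 u.
  move=> e1 er ue.
  have ve : (delta_mx 0 i0 : 'rV[K]_n) *m (e - delta_mx i0 0) = 0.
    rewrite -rowE; apply/matrixP => i j.
    by rewrite !ord1 !mxE e1 !eqxx subrr.
  have [b bE bVE] := transvection_exists ve.
  have r0 : 0 <= r by rewrite (le_trans _ (er i0 0))// absv_ge0.
  apply: (@thinJ _ _ b) => //; first by nra.
    rewrite /sized bE bVE; apply: bnd_transvection; first lra.
      by apply: bndD => //; apply: bndN; exact: bnd_delta.
    exact: bnd_delta.
  apply: first_transvection_thin.
  have -> : delta_mx i0 0 = val b^-1%g *m e.
    rewrite bVE mulmxBl mul1mx -mulmxA -rowE (_ : row i0 e = 1%:M).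
      by rewrite mulmx1 subKr.
    by apply/matrixP => i j; rewrite !ord1 !mxE e1.
  by have := is_transvectionJ b^-1%g ue; rewrite invgK.
exists (Num.max r1 (n%:R * (1 + (1 + r) * 1) * r1)) => k e u ek er ue.
have r1' : 1 <= r by rewrite -(absv1 nm) -ek.
have thin_le a b : a <= b -> thin a u -> thin b u.
  by move=> ab [c [h [cs Hh E]]]; exists c, h; split=> //;
    exact: sized_le ab cs.
have : k = 0 \/ k = 1.
  by case: k {ek} => -[|[|//]] lt; [left|right]; apply: val_inj.
case=> kE; rewrite {k}kE in ek.
  by apply: (thin_le r1); [rewrite le_max lexx|exact: (main e)].
apply: (thin_le (n%:R * (1 + (1 + r) * 1) * r1));
  first by rewrite le_max lexx orbT.
(* When coordinate 1 of e is the normalised one, adding 1 - e_0 times it to coordinate 0 makes the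
   latter equal to 1. *)
have te : (delta_mx 0 i1 : 'rV[K]_n) *m ((1 - e i0 0) *: delta_mx i0 0 :
  'cV[K]_n) = 0.
  by rewrite -scalemxAr mul_delta_mx_0// scaler0.
have [b bE bVE] := transvection_exists te.
have bs : sized nm (1 + (1 + r) * 1) b.
  rewrite /sized bE bVE; apply: bnd_transvection; [lra| |exact: bnd_delta].
  move=> i j; rewrite !mxE absvM -[leRHS]mulr1 ler_pM ?absv_ge0//.
    by rewrite (le_trans (absvB _ _ _))// absv1 lerD2l.
  by case: (_ && _); rewrite ?absv1 ?absv0.
have beE i : (val b *m e) i 0 = if i == i0 then 1 else e i 0.
  rewrite bE mulmxDl mul1mx -mulmxA -rowE !mxE big_ord1 !mxE ek mulr1 andbT.
  by case: eqVneq => [->|_]; [rewrite mulr1 addrCA subrr addr0|rewrite mulr0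
    addr0].
apply: (@thinJ _ _ b^-1%g); [lra|exact: sizedV|rewrite invgK].
apply: (main (val b *m e)); last exact: is_transvectionJ.
  by rewrite beE eqxx.
by move=> i j; rewrite ord1 beE; case: eqVneq => // _; rewrite absv1.
Qed.

End Thin.

(** * Pivoting in SL_2 *)

Section Pivot.
Variables (R : realType) (K : numFieldType) (nm : absval R K).
Implicit Types (a b c d : K) (A B l t w : SL K 2).

Definition mx2 a b c d : 'M[K]_2 := \matrix_(i, j)
  if i == 0 then if j == 0 then a else b else if j == 0 then c else d.

Lemma ord2P (P : 'I_2 -> Prop) : P 0 -> P 1 -> forall i, P i.
Proof.
move=> P0 P1 -[[|[|//]] lt].
  by rewrite (_ : Ordinal lt = 0)//; apply: val_inj.
by rewrite (_ : Ordinal lt = 1)//; apply: val_inj.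
Qed.

Lemma mx2E (M : 'M[K]_2) : M = mx2 (M 0 0) (M 0 1) (M 1 0) (M 1 1).
Proof. by apply/matrixP; apply: ord2P; apply: ord2P; rewrite mxE. Qed.

Lemma mx2M a b c d a' b' c' d' : mx2 a b c d *m mx2 a' b' c' d' =
  mx2 (a * a' + b * c') (a * b' + b * d') (c * a' + d * c') (c * b' + d * d').
Proof.
apply/matrixP; apply: ord2P; apply: ord2P;
by rewrite !mxE !big_ord_recl big_ord0 !mxE /= addr0.
Qed.

Lemma det_mx2 a b c d : \det (mx2 a b c d) = a * d - b * c.
Proof.
rewrite (expand_det_row _ 0) !big_ord_recl big_ord0 /cofactor !det_mx11 !mxE /=.
by rewrite addr0 expr0 expr1 mul1r mulN1r mulrN.
Qed.

Lemma SL2_mx2 a b c d : a * d - b * c = 1 -> exists A, val A = mx2 a b c d.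
Proof.
by move=> h; have h' : \det (mx2 a b c d) == 1; rewrite ?det_mx2 ?h//;
  exists (Sub (mx2 a b c d) h').
Qed.

Lemma bnd_mx2 r a b c d : nm a <= r -> nm b <= r -> nm c <= r -> nm d <= r ->
  bnd nm r (mx2 a b c d).
Proof. by move=> ? ? ? ?; apply: ord2P; apply: ord2P; rewrite mxE. Qed.

Lemma bnd_sized2 r A : bnd nm r (val A) -> sized nm r A.
Proof.
move=> Ar; split=> // i j; rewrite SL_invE det_mx11 absvM !mxE.
have -> : nm ((-1) ^+ (j + i)) = 1.
  by rewrite -signr_odd; case: odd; rewrite ?expr1 ?absvN absv1.
by rewrite mul1r.
Qed.

Lemma SL2_det A : val A 0 0 * val A 1 1 - val A 0 1 * val A 1 0 = 1.
Proof. by rewrite -det_mx2 -mx2E SL_det. Qed.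

(** The determinant bounds 1 by r times the sum of the absolute values in column 0. *)
Lemma SL2_col_ge r A : 0 < r -> bnd nm r (val A) -> exists k,
  (2 * r)^-1 <= nm (val A k 0).
Proof.
move=> r0 Ar; apply: contrapT => /forallNP H.
have h k : nm (val A k 0) < (2 * r)^-1 by rewrite ltNge; exact/negP.
suff : nm (1 : K) < 1 by rewrite absv1 ltxx.
rewrite -{1}(SL2_det A) (le_lt_trans (absvB _ _ _))// !absvM.
have le k : nm (val A k 0) * r < 2^-1.
  by rewrite -ltr_pdivlMr// -invfM.
have l1 : nm (val A 0 0) * nm (val A 1 1) <= nm (val A 0 0) * r.
  by rewrite ler_wpM2l ?absv_ge0.
have l2 : nm (val A 0 1) * nm (val A 1 0) <= nm (val A 1 0) * r.
  by rewrite mulrC ler_wpM2l ?absv_ge0.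
by have := le 0; have := le 1; lra.
Qed.

(** Row 1 of the inverse is column 0 of A, with its entries exchanged and up to sign. *)
Lemma SL2_inv_row_ge r A : 0 < r -> bnd nm r (val A) ->
  exists k, (2 * r)^-1 <= nm (val A^-1%g 1 k).
Proof.
move=> r0 /(SL2_col_ge r0)[k kr].
have H i : exists j, nm (val A^-1%g 1 j) = nm (val A i 0).
  exists (lift i 0); rewrite SL_invE det_mx11 absvM !mxE.
  have -> : nm ((-1) ^+ (lift i 0 + 1)) = 1.
    by rewrite -signr_odd; case: odd; rewrite ?expr1 ?absvN absv1.
  rewrite mul1r; congr (nm (val A _ _)); last by apply: val_inj.
  by move: i; apply: ord2P; apply: val_inj.
by have [j jE] := H k; exists j; rewrite jE.
Qed.

(** Elimination with complete pivoting, a coarse Cartan decomposition valid over any field with an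
    absolute value. The Weyl element w moves the largest entry lam to the corner, so the multipliers
    have absolute value at most 1; the determinant gives 1 <= 2 |lam|^2. The bound 2 is the
    dimension factor from [sizedM]. *)
Lemma SL2_pivot A : exists (l t r : SL K 2) (lam : K),
  [/\ A = (l * t * r)%g, val t = mx2 lam 0 0 lam^-1, 2^-1 <= nm lam,
      sized nm 2 l & sized nm 2 r].
Proof.
pose P A := exists (l t r : SL K 2) (lam : K),
  [/\ A = (l * t * r)%g, val t = mx2 lam 0 0 lam^-1, 2^-1 <= nm lam,
      sized nm 1 l & sized nm 1 r].
have main B : (forall i j, nm (val B i j) <= nm (val B 0 0)) -> P B.
  move=> Bmax; pose lam := val B 0 0.
  have lam2 : 2^-1 <= nm lam.
    rewrite leNgt; apply/negP => lt.
    suff : nm (1 : K) < 1 by rewrite absv1 ltxx.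
    rewrite -{1}(SL2_det B) (le_lt_trans (absvB _ _ _))// !absvM.
    have h i j i' j' : nm (val B i j) * nm (val B i' j') <= nm lam * nm lam.
      by rewrite ler_pM ?absv_ge0.
    have := h 0 0 1 1; have := h 0 1 1 0; have := absv_ge0 nm lam; nra.
  have lam0 : lam != 0 by apply: (@absv_neq0 _ _ nm); lra.
  have nlam0 : 0 < nm lam by lra.
  have q1 x : nm x <= nm lam -> nm (x / lam) <= 1.
    by move=> xl; rewrite absvM absvV ler_pdivrMr// mul1r.
  have [l lE] : exists l, val l = mx2 1 0 (val B 1 0 / lam) 1.
    by apply: SL2_mx2; rewrite mul1r mul0r subr0.
  have [t tE] : exists t, val t = mx2 lam 0 0 lam^-1.
    by apply: SL2_mx2; rewrite mulfV// mul0r subr0.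
  have [r rE] : exists r : SL K 2, val r = mx2 1 (val B 0 1 / lam) 0 1.
    by apply: SL2_mx2; rewrite mul1r mulr0 subr0.
  exists l, t, r, lam; split=> //.
  - apply: val_inj; transitivity (val l *m val t *m val r) => //.
    rewrite lE tE rE !mx2M [LHS]mx2E -/lam.
    have B11 : val B 1 1 = lam^-1 + val B 1 0 * val B 0 1 / lam.
      apply: (mulfI lam0); have /eqP := SL2_det B.
      by rewrite subr_eq -/lam => /eqP ->; field.
    by rewrite B11; congr mx2; field.
  - by apply: bnd_sized2; rewrite lE; apply: bnd_mx2; rewrite ?absv0 ?absv1 ?q1.
  - by apply: bnd_sized2; rewrite rE; apply: bnd_mx2; rewrite ?absv0 ?absv1 ?q1.
have [w wE] : exists w, val w = mx2 0 1 (-1) 0.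
  by apply: SL2_mx2; rewrite mul0r mul1r sub0r opprK.
have ws : sized nm 1 w.
  by apply: bnd_sized2; rewrite wE; apply: bnd_mx2;
    rewrite ?absvN ?absv0 ?absv1.
have s1 : sized nm 1 (1%g : SL K 2).
  apply: bnd_sized2 => i j; rewrite mxE; case: (i == j);
    rewrite ?absv1 ?absv0//.
have wl B i j : nm (val (w * B)%g i j) = nm (val B (i + 1) j).
  have -> : val (w * B)%g = val w *m val B by [].
  rewrite wE [val B]mx2E mx2M !mul0r !mul1r !add0r.
  by rewrite !addr0 !mulN1r; move: i j; apply: ord2P; apply: ord2P;
    rewrite !mxE ?absvN.
have wr B i j : nm (val (B * w)%g i j) = nm (val B i (j + 1)).
  have -> : val (B * w)%g = val B *m val w by [].
  rewrite wE [val B]mx2E mx2M !mulr0 !mulr1 !add0r.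
  by rewrite !addr0 !mulrN1; move: i j; apply: ord2P; apply: ord2P;
    rewrite !mxE ?absvN.
suff [p [q [ps qs /main [l [t [r [lam [E tE lam2 ls rs]]]]]]]] : exists p q :
  SL K 2,
    [/\ sized nm 1 p, sized nm 1 q &
        forall i j, nm (val (p * A * q)%g i j) <= nm (val (p * A * q)%g 0 0)].
  exists (p^-1 * l)%g, t, (r * q^-1)%g, lam; split=> //.
  - transitivity (p^-1 * (p * A * q) * q^-1)%g; last by rewrite E !mulgA.
    by rewrite !mulgA mulVg mul1g mulgK.
  - by have := sizedM ler01 ler01 (sizedV ps) ls; rewrite !mulr1.
  - by have := sizedM ler01 ler01 rs (sizedV qs); rewrite !mulr1.
have [[i j] _ ijmax] := @Order.TotalTheory.arg_maxP _ R _ (0 : 'I_2,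
  0 : 'I_2) xpredT
  (fun ij => nm (val A ij.1 ij.2)) isT.
have {}ijmax i' j' : nm (val A i' j') <= nm (val A i j) by exact: (ijmax (i',
  j')).
have k01 (k : 'I_2) : k = 0 \/ k = 0 + 1.
  by move: k; apply: ord2P; [left|right]; apply: val_inj.
case: (k01 i) (k01 j) ijmax => -> [] -> ijmax.
- by exists 1%g, 1%g; split=> // i' j'; rewrite mulg1 mul1g.
- by exists 1%g, w; split=> // i' j'; rewrite mul1g !wr.
- by exists w, 1%g; split=> // i' j'; rewrite mulg1 !wl.
- by exists w, w; split=> // i' j'; rewrite !wr !wl.
Qed.

End Pivot.

(** * Counting *)

Section Counting.
Variable R : realFieldType.

Lemma card_ffun_forall (I T : finType) (P : I -> pred T) :
  #|[pred f : {ffun I -> T} | [forall i, P i (f i)]]| = (\prod_i #|P i|)%N.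
Proof.
rewrite -[RHS]big_enum -[RHS](big_map (fun i => #|P i|) xpredT id) -foldrE.
rewrite [RHS](_ : _ = foldr muln 1%N [seq #|P i| | i : I]) // -card_family.
by apply: eq_card => f; rewrite !inE.
Qed.

Lemma card_ffun_forall_le (I T : finType) (P : I -> pred T) (q : R) :
  (forall i, #|P i|%:R <= q) ->
  #|[pred f : {ffun I -> T} | [forall i, P i (f i)]]|%:R <= q ^+ #|I|.
Proof.
move=> Pq; rewrite card_ffun_forall natr_prod -prodr_const.
by apply: ler_prod => i _; rewrite ler0n Pq.
Qed.

Lemma card_ffun_forall_ge (I T : finType) (P : I -> pred T) (k : I) (q : R) :
  0 <= q -> (forall i, i != k -> q <= #|P i|%:R) -> (forall t, P k t) ->
  #|T|%:R * q ^+ #|I|.-1 <=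
  #|[pred f : {ffun I -> T} | [forall i, P i (f i)]]|%:R.
Proof.
move=> q0 Pq Pk; rewrite card_ffun_forall natr_prod (bigD1 k)//=.
rewrite (_ : #|P k| = #|T|); last by apply: eq_card => t; rewrite !inE;
  exact: Pk.
rewrite ler_wpM2l// (_ : q ^+ _ = \prod_(i | i != k) q).
  by apply: ler_prod => i ik; rewrite q0 Pq.
by rewrite prodr_const -(cardC1 k).
Qed.

Lemma card_pair_le (A B : finType) (P : A -> B -> bool) (Q : pred B) (p q : R) :
  0 <= p -> #|Q|%:R <= q -> (forall b, Q b -> #|[pred a | P a b]|%:R <= p) ->
  #|[pred x : A * B | Q x.2 && P x.1 x.2]|%:R <= p * q.
Proof.
move=> p0 Qq Pp; have -> : #|[pred x : A * B | Q x.2 && P x.1 x.2]| =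
    (\sum_(b | Q b) #|[pred a | P a b]|)%N.
  rewrite -sum1_card (eq_bigr (fun b => \sum_(a | P a b) 1)%N); last first.
    by move=> b _; rewrite -sum1_card.
  rewrite pair_big_dep /= (reindex (fun x : B * A => (x.2, x.1))) //=.
  by exists (fun x : A * B => (x.2, x.1)) => -[].
rewrite natr_sum; apply: (@le_trans _ _ (\sum_(b | Q b) p)).
  by apply: ler_sum => b; exact: Pp.
by rewrite sumr_const -mulr_natr ler_wpM2l.
Qed.

Lemma sum_card_count (G : eqType) (s : seq G) (Z : finType) (D : G ->
  pred Z) (M : R) :
  (forall z, (count (D^~ z) s)%:R <= M) ->
  \sum_(g <- s) #|D g|%:R <= M * #|Z|%:R :> R.
Proof.
move=> DM; apply: (@le_trans _ _ (\sum_(z : Z) (count (D^~ z) s)%:R)).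
  have -> : \sum_(z : Z) (count (D^~ z) s)%:R = \sum_(z :
    Z) \sum_(g <- s) (D g z)%:R :> R.
    apply: eq_bigr => z _; rewrite -sum1_count natr_sum big_mkcond.
    by apply: eq_bigr => g _; case: (D g z).
  rewrite exchange_big /=; apply: ler_sum => g _.
  rewrite -sum1_card natr_sum big_mkcond ler_sum// => z _.
  by rewrite unfold_in; case: (D g z).
apply: (@le_trans _ _ (\sum_(z : Z) M)); first by apply: ler_sum => z _;
  exact: DM.
by rewrite sumr_const mulr_natr.
Qed.

Lemma card_le_sum (G : eqType) (s : seq G) (T : finType) (E : G -> pred T) :
  (forall t, has (E^~ t) s) -> #|T|%:R <= \sum_(g <- s) #|E g|%:R :> R.
Proof.
move=> cov; rewrite -natr_sum ler_nat.
have -> : (\sum_(g <- s) #|E g| = \sum_(t : T) count (E^~ t) s)%N.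
  transitivity (\sum_(g <- s) \sum_(t : T) E g t)%N.
    apply: eq_bigr => g _; rewrite -sum1_card big_mkcond.
    by apply: eq_bigr => t _; rewrite unfold_in; case: (E g t).
  rewrite exchange_big /=; apply: eq_bigr => t _.
  by rewrite -sum1_count [RHS]big_mkcond; apply: eq_bigr => g _; case: (E g t).
rewrite -sum1_card; apply: leq_sum => t _.
by rewrite -has_count.
Qed.

(** In terms of proportions: the E g cover T, so theirs add up to at least 1; each z lies in at most
    M of the D g, so theirs add up to at most M; and termwise the former are at most eps times the
    latter. *)
Lemma double_counting (G : eqType) (s : seq G) (T Z : finType)
    (E : G -> pred T) (D : G -> pred Z) (M eps : R) :
  (0 < #|T|)%N -> (0 < #|Z|)%N -> 0 <= eps ->
  (forall t, has (E^~ t) s) -> (forall z, (count (D^~ z) s)%:R <= M) ->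
  (forall g, g \in s -> #|E g|%:R * #|Z|%:R <= eps * #|D g|%:R * #|T|%:R) ->
  1 <= eps * M.
Proof.
move=> T0 Z0 e0 cov DM ED.
have TZ : 0 < #|T|%:R * #|Z|%:R :> R by rewrite mulr_gt0 ?ltr0n.
rewrite -(ler_pM2r TZ) mul1r.
apply: (@le_trans _ _ (\sum_(g <- s) #|E g|%:R * #|Z|%:R)).
  by rewrite -mulr_suml ler_wpM2r ?ler0n// card_le_sum.
apply: (@le_trans _ _ (\sum_(g <- s) eps * #|D g|%:R * #|T|%:R)).
  by rewrite !big_seq; apply: ler_sum.
rewrite -mulr_suml -mulr_sumr [leRHS](_ : _ = eps * (M * #|Z|%:R) * #|T|%:R);
  last by ring.
by rewrite ler_wpM2r ?ler0n// ler_wpM2l// sum_card_count.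
Qed.

End Counting.

(** * Orbits of H met by a given element *)

Section UnipotentFamily.
Variables (R : realType) (K : numFieldType) (nm : absval R K) (m : nat).
Local Notation n := (2 + m)%N.
Local Notation G := (SL K n).
Local Notation H := (@SL2_upper_left K n).
Local Notation d := (absv_dim nm).
Implicit Types (X : 'M[K]_(m, 2)) (Y : 'M[K]_(2, m)).

(** This is the product of an upper and a lower block unipotent, ordered so that X and Y themselves
    are the off-diagonal blocks of the inverse. *)
Lemma unipotent_exists X Y : exists y : G,
  val y = block_mx (1%:M + Y *m X) (- Y) (- X) 1%:M /\
  val y^-1%g = block_mx 1%:M Y X (X *m Y + 1%:M).
Proof.
have E1 : block_mx (1%:M + Y *m X) (- Y) (- X) 1%:M =
    block_mx 1%:M (- Y) 0 1%:M *m block_mx 1%:M 0 (- X) 1%:M.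
  by rewrite mulmx_block !mul1mx !mulmx1 !mul0mx mulmxN mulNmx opprK ?mulmx0
    !add0r.
have E2 : block_mx 1%:M Y X (X *m Y + 1%:M) =
    block_mx 1%:M 0 X 1%:M *m block_mx 1%:M Y 0 1%:M.
  by rewrite mulmx_block !mul1mx !mulmx1 !mul0mx ?mulmx0 !addr0.
have d1 : \det (block_mx (1%:M + Y *m X) (- Y) (- X) 1%:M) == 1.
  by rewrite E1 det_mulmx det_ublock det_lblock !det1 !mul1r.
have d2 : \det (block_mx 1%:M Y X (X *m Y + 1%:M)) == 1.
  by rewrite E2 det_mulmx det_ublock det_lblock !det1 !mul1r.
pose y : G := Sub (block_mx (1%:M + Y *m X) (- Y) (- X) 1%:M) d1.
pose y' : G := Sub (block_mx 1%:M Y X (X *m Y + 1%:M)) d2.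
exists y; split=> //; have -> : (y^-1)%g = y'; last by [].
apply: (mulgI y); rewrite mulgV; apply/val_inj => /=.
rewrite mulmx_block !mulmx1 !mul1mx !mulNmx addrK addNr.
rewrite mulmxDl mulmxDr mul1mx mulmx1 mulmxA (addrC (Y *m X *m Y)) subrr.
by rewrite (addrC (X *m Y)) addrCA addNr addr0 -scalar_mx_block.
Qed.

Definition unipotent X Y : G := projT1 (cid (unipotent_exists X Y)).

Lemma val_unipotent X Y :
  val (unipotent X Y) = block_mx (1%:M + Y *m X) (- Y) (- X) 1%:M.
Proof. by rewrite /unipotent; case: cid => y []. Qed.

Lemma val_unipotentV X Y :
  val (unipotent X Y)^-1%g = block_mx 1%:M Y X (X *m Y + 1%:M).
Proof. by rewrite /unipotent; case: cid => y []. Qed.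

Lemma bnd_block p1 p2 q1 q2 r (A : 'M[K]_(p1, q1)) (B : 'M[K]_(p1, q2))
    (C : 'M[K]_(p2, q1)) (D : 'M[K]_(p2, q2)) :
  bnd nm r A -> bnd nm r B -> bnd nm r C -> bnd nm r D ->
  bnd nm r (block_mx A B C D).
Proof.
move=> Ar Br Cr Dr i j; case: (split_ordP i) => k ->;
  case: (split_ordP j) => l ->.
- by rewrite block_mxEul.
- by rewrite block_mxEur.
- by rewrite block_mxEdl.
- by rewrite block_mxEdr.
Qed.

Lemma sized_unipotent X Y : bnd nm (4 * n%:R)^-1 X -> bnd nm (4 * n%:R)^-1 Y ->
  sized nm 2 (unipotent X Y).
Proof.
set e := (4 * n%:R)^-1 => Xe Ye.
have n0 : 2 <= n%:R :> R by rewrite ler_nat leq_addr.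
have n1 : m%:R <= n%:R :> R by rewrite ler_nat leq_addl.
have m0 : 0 <= m%:R :> R by rewrite ler0n.
have e0 : 0 <= e by rewrite invr_ge0; lra.
have ne : n%:R * e = 4^-1 by rewrite /e; field; lra.
have e1 : e <= 1 by move: n0 n1 ne; set x := (n%:R : R); nra.
have em : m%:R * e * e <= 1.
  by move: n0 n1 ne; set x := (n%:R : R); set z := (m%:R : R) in m0 *; nra.
have e2 : 2 * e * e <= 1.
  by move: n0 n1 ne; set x := (n%:R : R); nra.
have YX : bnd nm 1 (Y *m X) by apply: bnd_le em _; exact: bndM.
have XY : bnd nm 1 (X *m Y) by apply: bnd_le e2 _; exact: bndM.
have b2 p : bnd nm 2 (1%:M : 'M[K]_p) by apply: bnd_le (@bnd1 _ _ nm p);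
  rewrite ler1n.
have Xb : bnd nm 2 X by apply: bnd_le Xe; lra.
have Yb : bnd nm 2 Y by apply: bnd_le Ye; lra.
rewrite /sized val_unipotent val_unipotentV; split.
  apply: bnd_block => //; [|exact: bndN|exact: bndN].
  by rewrite (_ : 2 = 1 + 1)//; apply: bndD => //; exact: bnd1.
apply: bnd_block => //.
by rewrite (_ : 2 = 1 + 1)//; apply: bndD => //; exact: bnd1.
Qed.

(* The 2m scalar conditions, each of precision rho / lam, say that the last m
   columns of (y^-1 g)^-1 and the last m rows of y^-1 g stay bounded. *)
Lemma unipotent_conditions X Y X0 Y0 (l t A : SL K 2) (lam : K) (c C : G) rho :
  lam != 0 -> val t = mx2 lam 0 0 lam^-1 ->
  (unipotent X Y * upper_left m A * c =
   unipotent X0 Y0 * upper_left m l * upper_left m t * C)%g ->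
  bnd nm rho (val (c * C^-1)%g) -> bnd nm rho (val (C * c^-1)%g) ->
  (forall i, nm (lam * ((X *m (1%:M + (Y0 - Y) *m X0) - X0) *m val l) i 0) <=
    rho) /\
  (forall j, nm (lam * (val l^-1%g *m (Y0 - Y)) 1 j) <= rho).
Proof.
move=> lam0 tE E cC Cc; split.
  move=> i.
  (* On the right, the unknown A does not affect the last m rows. On the left, column 0 of t
     contributes the factor lam. *)
  have E1 : ((unipotent X Y)^-1 * unipotent X0 Y0 * upper_left m (l * t)
      = upper_left m A * (c * C^-1))%g.
    apply: (mulgI (unipotent X Y)); apply: (mulIg C).
    by rewrite upper_leftM !mulgA mulgV mul1g -E mulgVK.
  have := cC (rshift 2 i) (lshift m 0).
  suff -> : val (c * C^-1)%g (rshift 2 i) (lshift m 0) =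
    lam * ((X *m (1%:M + (Y0 - Y) *m X0) - X0) *m val l) i 0 by [].
  have := congr1 (fun g : G => dlsubmx (val g) i 0) E1.
  set P := (c * C^-1)%g.
  have -> : val (upper_left m A * P)%g = val (upper_left m A) *m val P by [].
  rewrite val_upper_left -[X in _ *m X]submxK mulmx_block block_mxKdl.
  have <- : dlsubmx (val P) i 0 = val P (rshift 2 i) (lshift m 0) by rewrite
    !mxE.
  rewrite mul0mx mul1mx add0r => <-.
  have -> : val ((unipotent X Y)^-1 * unipotent X0 Y0 * upper_left m (l *
    t))%g =
    val (unipotent X Y)^-1%g *m val (unipotent X0 Y0) *m val (upper_left m (l *
      t)%g) by [].
  rewrite val_unipotentV val_unipotent val_upper_left !mulmx_block block_mxKdl.
  rewrite mulmx0 addr0 -[RHS]/(_ * _).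
  have -> : val (l * t)%g = val l *m val t by [].
  rewrite tE mulmxA.
  have col0 (M : 'M[K]_(m, 2)) : (M *m mx2 lam 0 0 lam^-1) i 0 = lam * M i 0.
    by rewrite mxE !big_ord_recl big_ord0 !mxE /= mulr0 !addr0 mulrC.
  rewrite col0; congr (_ * (_ *m _) _ _).
  rewrite mulmxN mulmxDl mul1mx !mulmxDr !mulmx1 !mulmxBl mulmxBr opprD !mulmxA
    !addrA.
  by rewrite addrAC.
move=> j.
have tV : val t^-1%g = mx2 lam^-1 0 0 lam.
  have [t' t'E] : exists t' : SL K 2, val t' = mx2 lam^-1 0 0 lam.
    by apply: SL2_mx2; rewrite mulVf// mulr0 subr0.
  rewrite -t'E; congr val; apply: (mulgI t); rewrite mulgV; apply: val_inj.
  have -> : val (t * t')%g = val t *m val t' by [].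
  rewrite tE t'E mx2M !mulr0 !mul0r !addr0 add0r.
  rewrite mulfV// mulVf//; apply/matrixP; apply: ord2P; apply: ord2P;
    by rewrite !mxE.
(* For the inverse relation, A^-1 does not affect the last m columns, and it is row 1 of t^-1 that
   contributes lam. *)
have E2 : (upper_left m (t^-1 * l^-1) * ((unipotent X0 Y0)^-1 * unipotent X Y)
    = (C * c^-1) * upper_left m A^-1)%g.
  rewrite -invgM -!upper_leftV upper_leftM.
  apply: (mulgI (upper_left m l * upper_left m t)%g).
  apply: (mulgI (unipotent X0 Y0)); apply: (mulIg (upper_left m A * c)%g).
  by rewrite !mulVKg mulgA E !mulgA !mulgVK.
have := Cc (lshift m 1) (rshift 2 j).
have := congr1 (fun g : G => ursubmx (val g) 1 j) E2.
set P := (C * c^-1)%g.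
have -> : val (P * upper_left m A^-1)%g = val P *m val (upper_left m A^-1%g) by
  [].
rewrite val_upper_left -[X in X *m _]submxK mulmx_block block_mxKur.
have <- : ursubmx (val P) 1 j = val P (lshift m 1) (rshift 2 j) by rewrite !mxE.
rewrite mulmx0 mulmx1 add0r => <-.
have -> : val (upper_left m (t^-1 * l^-1) * ((unipotent X0 Y0)^-1 *
  unipotent X Y))%g =
  val (upper_left m (t^-1 * l^-1)%g) *m (val (unipotent X0 Y0)^-1%g *m val
    (unipotent X Y)) by [].
rewrite val_unipotentV val_unipotent val_upper_left !mulmx_block block_mxKur.
rewrite mul0mx addr0.
have -> : val (t^-1 * l^-1)%g = val t^-1%g *m val l^-1%g by [].
rewrite tV -mulmxA.
have row1 (M : 'M[K]_(2, m)) : (mx2 lam^-1 0 0 lam *m M) 1 j = lam * M 1 j.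
  rewrite mxE !big_ord_recl big_ord0 !mxE /= mul0r addr0 add0r.
  by congr (_ * M _ _); apply: val_inj.
rewrite row1 mul1mx mulmx1 (addrC (- Y)); exact.
Qed.

End UnipotentFamily.

(** * Proportion of the unipotent family subject to the affine conditions *)

Section UnipotentCount.
Variables (R : realType) (K : numFieldType) (nm : absval R K) (m : nat).
Local Notation n := (2 + m)%N.
Local Notation d := (absv_dim nm).
(** Column 0 of l has an entry of size at least 1/4, and the perturbation Y X l is at most 8 m e^2
    <= 1/8, where e = 1 / (4n) <= 1/16. *)
Lemma perturbed_col_ge (X : 'M[K]_(m, 2)) (Y : 'M[K]_(2, m)) (l : SL K 2) :
  (2 <= m)%N -> bnd nm (4 * n%:R)^-1 X -> bnd nm ((4 * n%:R)^-1 + (4 *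
    n%:R)^-1) Y ->
  bnd nm 2 (val l) -> exists k, 8^-1 <= nm (((1%:M + Y *m X) *m val l) k 0).
Proof.
move=> m2 Xb Yb l2; have n0 : 4 <= n%:R :> R by rewrite ler_nat; lia.
have two0 : 0 < 2 :> R by lra.
have [k kl] := SL2_col_ge (nm := nm) two0 l2.
exists k; rewrite mulmxDl mul1mx mxE.
set W := (_ *m X).
have Wb : bnd nm 8^-1 (W *m val l).
  have e0 : 0 < (4 * n%:R)^-1 :> R by rewrite invr_gt0; lra.
  have en : n%:R * (4 * n%:R)^-1 = 4^-1 :> R by field; lra.
  have mn : m%:R <= n%:R :> R by rewrite ler_nat leq_addl.
  have m0 : 0 <= m%:R :> R by rewrite ler0n.
  have W1 := bndM _ Yb Xb.
  apply: bnd_le (bndM _ (W1 _) l2); first last.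
  - lra.
  - by rewrite !mulr_ge0//; lra.
  set e := (_ * _)^-1 in e0 en *.
  have me : m%:R * e <= 4^-1 by rewrite -en ler_wpM2r// ltW.
  have e16 : e <= 16^-1 by rewrite lef_pV2 ?posrE; lra.
  nra.
have := absvD_ge nm (val l k 0) ((W *m val l) k 0); have := Wb k 0.
lra.
Qed.

Variables (cg N : R) (T : finType) (pt : T -> K).
Hypotheses (N0 : 0 < N) (cg0 : 0 < cg) (gT :
  fine_grid nm (absv_dim nm) cg N pt).

(** With the variable of the other coefficient held fixed, the condition confines one grid point to
    a ball of radius rho / L. *)
Lemma card_affine_le (a b c : K) (L rho : R) : 0 < L ->
  L <= nm a \/ L <= nm b ->
  N^-1 <= rho / L ->
  #|[pred t : T * T | nm (a * pt t.1 + b * pt t.2 + c) <= rho]|%:R <=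
    (cg * (rho / L)) ^+ d * #|T|%:R * #|T|%:R :> R.
Proof.
move=> L0 ab Nr; have [_ _ H] := gT.
have rL0 : 0 <= rho / L by rewrite (le_trans _ Nr)// invr_ge0 ltW.
have p0 : 0 <= (cg * (rho / L)) ^+ d * #|T|%:R.
  by rewrite mulr_ge0// exprn_ge0// mulr_ge0// ltW.
have main (a' c' : K) : L <= nm a' ->
    #|[pred t | nm (a' * pt t + c') <= rho]|%:R <= (cg * (rho / L)) ^+ d *
      #|T|%:R :> R.
  move=> La; have a0 : a' != 0 by apply: (@absv_neq0 _ _ nm);
    apply: lt_le_trans La.
  have [+ _] := H (- (c' / a')) _ Nr; apply: le_trans.
  rewrite ler_nat; apply/subset_leq_card/fintype.subsetP => t;
    rewrite !inE => tr.
  rewrite opprK (_ : pt t + c' / a' = (a' * pt t + c') / a'); last by field.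
  rewrite absvM absvV ler_pdivrMr; last exact: lt_le_trans La.
  apply: le_trans tr _; rewrite mulrAC ler_pdivlMr//.
  by rewrite ler_wpM2l//; have := rL0; rewrite pmulr_lge0// invr_gt0.
have cT : #|[pred t : T | xpredT t]|%:R <= (#|T|%:R : R) by [].
case: ab => Lab.
  apply: (@card_pair_le _ _ _ (fun x y => nm (a * pt x + b * pt y + c) <=
    rho) xpredT) => //.
  move=> t _; rewrite (@eq_card _ _ [pred x | nm (a * pt x + (b * pt t + c)) <=
    rho]).
    exact: main.
  by move=> x; rewrite !inE addrA.
pose sw (t : T * T) := (t.2, t.1).
have swK : involutive sw by case.
rewrite -(fintype.card_image (inv_inj swK)).
rewrite (@eq_card _ _ [pred t : T * T | xpredT t.2 && (nm (b * pt t.1 + (a *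
  pt t.2 + c)) <= rho)]); last first.
  move=> t; rewrite !inE -[t in t \in _]swK fintype.mem_image ?inE;
    last exact: inv_inj.
  by rewrite /= addrA (addrC (b * _)).
apply: (@card_pair_le _ _ _ (fun x y => nm (b * pt x + (a * pt y + c)) <=
  rho) xpredT) => // t _.
exact: main.
Qed.

(** One pair of grid points per row: each condition to be counted involves a single row, so the
    counts factor over the rows. *)
Definition grid_mx (eta : K) (f : {ffun 'I_m -> T * T}) : 'M[K]_(m, 2) :=
  \matrix_(i, k) (eta * pt (if k == 0 then (f i).1 else (f i).2)).

Lemma bnd_grid_mx (eta : K) (f : {ffun 'I_m ->
  T * T}) : nm eta = (8 * n%:R)^-1 ->
  bnd nm (4 * n%:R)^-1 (grid_mx eta f).
Proof.
move=> etaE i j; rewrite !mxE absvM etaE.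
have n0 : 2 <= n%:R :> R by rewrite ler_nat leq_addr.
apply: (@le_trans _ _ ((8 * n%:R)^-1 * 2)).
  by rewrite ler_wpM2l ?invr_ge0 ?mulr_ge0//; have [_ + _] := gT; exact.
by rewrite (_ : _ * 2 = (4 * n%:R)^-1)//; field; lra.
Qed.

(** The conditions on Y do not involve X, and for fixed Y those on X are affine in its rows, so the
    count is done over Y and then fibrewise over X. Every condition has a coefficient of size at
    least 1/8, the origin of the 8 in r. *)
Lemma card_unipotent_conditions (X0 : 'M[K]_(m, 2)) (Y0 : 'M[K]_(2, m))
    (l : SL K 2) (lam eta : K) (rho : R) (r := 8 * rho / (nm eta * nm lam)) :
  (2 <= m)%N -> lam != 0 -> nm eta = (8 * n%:R)^-1 -> N^-1 <= r ->
  bnd nm (4 * n%:R)^-1 X0 -> bnd nm (4 * n%:R)^-1 Y0 -> sized nm 2 l ->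
  #|[pred th : {ffun 'I_m -> T * T} * {ffun 'I_m -> T * T} |
      [forall j, nm (lam * (val l^-1%g *m (Y0 - (grid_mx eta th.2)^T)) 1 j) <=
        rho] &&
      [forall i, nm (lam * ((grid_mx eta th.1 *m
         (1%:M + (Y0 - (grid_mx eta th.2)^T) *m X0) - X0) *m val l) i 0) <=
           rho]]|%:R
   <= ((cg * r) ^+ d) ^+ (2 * m) * #|T|%:R ^+ (4 * m) :> R.
Proof.
move=> m2 lam0 etaE Nr X0b Y0b [l2 l2'].
have nlam : 0 < nm lam by exact: absv_gt0.
have n0 : 4 <= n%:R :> R by rewrite ler_nat; lia.
have two0 : 0 < 2 :> R by lra.
have eta0 : 0 < nm eta by rewrite etaE invr_gt0; lra.
pose q := (cg * r) ^+ d * #|T|%:R * #|T|%:R.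
have rE : r = rho / nm lam / (nm eta / 8).
  by rewrite /r; field; rewrite !gt_eqF.
have affine (a b c : K) : 8^-1 <= nm a \/ 8^-1 <= nm b ->
   #|[pred t : T * T | nm (lam * (eta * (a * pt t.1 + b * pt t.2) + c)) <=
     rho]|%:R <= q.
  move=> ab; rewrite /q rE; have eta8 : 0 < nm eta / 8 by lra.
  have := @card_affine_le (eta * a) (eta * b) c (nm eta / 8) (rho / nm lam)
    eta8.
  rewrite !absvM !ler_pM2l// -rE => /(_ ab Nr).
  apply: le_trans; rewrite ler_nat; apply/subset_leq_card/fintype.subsetP => t.
  by rewrite !inE absvM mulrDr !mulrA ler_pdivlMr// mulrC.
have q0 : 0 <= q.
  by apply: le_trans (affine 1 0 0 _); rewrite ?ler0n// absv1; left; lra.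
have -> : ((cg * r) ^+ d) ^+ (2 * m) * #|T|%:R ^+ (4 * m) = q ^+ m * q ^+ m.
  rewrite -exprD addnn -mul2n /q -mulrA -expr2 [RHS]exprMn; congr (_ * _).
  by rewrite -exprM; congr (_ ^+ _); lia.
have Yb (f : {ffun 'I_m -> T * T}) : bnd nm (4 * n%:R)^-1 (grid_mx eta f)^T.
  by move=> i j; rewrite mxE; exact: bnd_grid_mx.
have col_ge f : exists k, 8^-1 <= nm (((1%:M + (Y0 - (grid_mx eta f)^T) *m X0)
  *m val l) k 0).
  by apply: perturbed_col_ge => //; exact: bndD Y0b (bndN (Yb f)).
have [k kl] : exists k, 8^-1 <= nm (val l^-1%g 1 k).
  have [k kl] := SL2_inv_row_ge (nm := nm) two0 l2.
  by exists k; lra.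
apply: (@card_pair_le _ _ _ (fun a b => [forall i, nm (lam * ((grid_mx eta a *m
         (1%:M + (Y0 - (grid_mx eta b)^T) *m X0) - X0) *m val l) i 0) <= rho])
   (fun b => [forall j, nm (lam * (val l^-1%g *m (Y0 - (grid_mx eta b)^T)) 1 j)
     <= rho])).
- exact: exprn_ge0.
- pose P (j : 'I_m) : pred (T * T) := fun t => nm (lam * (eta *
    (- val l^-1%g 1 0 * pt t.1 + - val l^-1%g 1 1 * pt t.2) +
      (val l^-1%g *m Y0) 1 j)) <= rho.
  rewrite -[X in q ^+ X](card_ord m) (@eq_card _ _ [pred f : {ffun 'I_m ->
    T * T} | [forall j, P j (f j)]]).
    apply: card_ffun_forall_le => j; apply: affine; rewrite !absvN.
    by move: k kl; apply: ord2P => ?; [left|right].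
  move=> f; rewrite !inE /=; apply: eq_forallb => j; rewrite /P;
    congr (nm (_ * _) <= _).
  transitivity ((val l^-1%g *m Y0) 1 j - (val l^-1%g *m (grid_mx eta f)^T) 1 j).
    by rewrite mulmxBr !mxE.
  rewrite [LHS]addrC; congr (_ + _).
  rewrite mxE !big_ord_recl big_ord0 !mxE /= addr0.
  rewrite (_ : lift ord0 ord0 = 1); last exact: val_inj.
  by rewrite (_ : ord0 = 0)//; ring.
- move=> b _; set V := (1%:M + (Y0 - (grid_mx eta b)^T) *m X0) *m val l.
  pose P (i : 'I_m) : pred (T * T) := fun t => nm (lam * (eta *
    (V 0 0 * pt t.1 + V 1 0 * pt t.2) - (X0 *m val l) i 0)) <= rho.
  rewrite -[X in q ^+ X](card_ord m) (@eq_card _ _ [pred f : {ffun 'I_m ->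
    T * T} | [forall i, P i (f i)]]).
    apply: card_ffun_forall_le => i; apply: affine.
    have [k' k'l] := col_ge b.
    by move: k' k'l; apply: ord2P => ?; [left|right].
  move=> f; rewrite !inE /=; apply: eq_forallb => i; rewrite /P;
    congr (nm (_ * _) <= _).
  transitivity ((grid_mx eta f *m V) i 0 - (X0 *m val l) i 0).
    by rewrite mulmxBl -mulmxA -/V !mxE.
  congr (_ - _).
  rewrite mxE !big_ord_recl big_ord0 !mxE /= addr0.
  rewrite (_ : lift ord0 ord0 = 1); last exact: val_inj.
  by rewrite (_ : ord0 = 0)//; ring.
Qed.

End UnipotentCount.

(** The surplus exponent 2m - (m + 1) = m - 1 is positive, so the quotient of the two sides is
    O(1/b). The leading factor 2 will absorb the cardinal of ['I_2]. *)
Lemma power_gap (R : realFieldType) (c1 c2 eps : R) (d m : nat) :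
  0 < c1 -> 0 < c2 -> 0 < eps -> (0 < d)%N -> (2 <= m)%N ->
  exists T : R, forall b, T <= b -> 0 < b ->
    2 * ((c1 / b) ^+ d) ^+ (2 * m) <= eps * ((c2 / b) ^+ d) ^+ m.+1.
Proof.
move=> c10 c20 eps0 d0 m2; pose L := ((c1 / c2) ^+ d) ^+ m.+1.
have L0 : 0 < L by rewrite !exprn_gt0// divr_gt0.
exists (c1 + 2 * L * c1 / eps) => b Tb b0.
have q0 : 0 < 2 * L * c1 / eps by rewrite divr_gt0// !mulr_gt0.
have c1b : c1 / b <= 1 by rewrite ler_pdivrMr// mul1r (le_trans _ Tb)// lerDl
  ltW.
have c1b0 : 0 <= c1 / b by rewrite divr_ge0// ltW.
have p0 : 0 <= (c1 / b) ^+ d by exact: exprn_ge0.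
have -> : ((c1 / b) ^+ d) ^+ (2 * m) =
    L * ((c2 / b) ^+ d) ^+ m.+1 * ((c1 / b) ^+ d) ^+ m.-1.
  rewrite /L -exprMn -exprMn (_ : c1 / c2 * (c2 / b) = c1 / b); last first.
    by field; rewrite !gt_eqF.
  by rewrite -exprD; congr (_ ^+ _); lia.
have le1 : ((c1 / b) ^+ d) ^+ m.-1 <= c1 / b.
  rewrite -exprM -[leRHS]expr1; apply: ler_wiXn2l => //; nia.
have qb : 2 * L * (c1 / b) <= eps.
  by rewrite mulrA ler_pdivrMr// [leRHS]mulrC -ler_pdivrMr// (le_trans _ Tb)//
    lerDr ltW.
have Q0 : 0 <= ((c2 / b) ^+ d) ^+ m.+1 by rewrite !exprn_ge0// divr_ge0 ?ltW.
apply: (@le_trans _ _ (2 * L * (c1 / b) * ((c2 / b) ^+ d) ^+ m.+1));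
  last exact: ler_wpM2r.
rewrite [leLHS](_ : _ = 2 * L * ((c2 / b) ^+ d) ^+ m.+1 * ((c1 / b) ^+ d) ^+
  m.-1); last by ring.
by rewrite [leRHS]mulrAC ler_wpM2l// !mulr_ge0// ltW.
Qed.

(** * Transvection groups passing near a given element *)

Section TransvectionCount.
Variables (R : realType) (K : numFieldType) (nm : absval R K) (m : nat).
Local Notation n := (2 + m)%N.
Local Notation G := (SL K n).
Local Notation d := (absv_dim nm).
Let i0 : 'I_n := lshift m 0.
Let i1 : 'I_n := lshift m 1.

Lemma mul_upper_left_diag (M : 'M[K]_n) (t : SL K 2) lam i :
  val t = mx2 lam 0 0 lam^-1 ->
  [/\ (M *m val (upper_left m t)) i i0 = lam * M i i0,
      (M *m val (upper_left m t)) i i1 = lam^-1 * M i i1 &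
      forall j, (M *m val (upper_left m t)) i (rshift 2 j) = M i (rshift 2 j)].
Proof.
move=> tE; rewrite val_upper_left -{1 3 5}(hsubmxK M) mul_row_block.
rewrite !mulmx0 addr0 add0r mulmx1 tE; split=> [||j].
- rewrite row_mxEl mxE !big_ord_recl big_ord0 !mxE /= mulr0 !addr0 mulrC.
  by congr (_ * M _ _); apply: val_inj.
- rewrite row_mxEl mxE !big_ord_recl big_ord0 !mxE /= mulr0 add0r addr0 mulrC.
  by congr (_ * M _ _); apply: val_inj.
- by rewrite row_mxEr mxE.
Qed.

(** This brings U_w within bounded distance of t. In column 0 the entries lam w_i / w_0 stay bounded
    because w_i = O(s / lam) for i <> 0; in column 1 the entries w_i / (lam w_1) stay bounded
    because w_1 is comparable to s / lam. The precision |s| / (4 |lam|) guarantees both. *)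
Lemma contracting_direction (t : SL K 2) (lam s : K) (w : 'cV[K]_n) :
  val t = mx2 lam 0 0 lam^-1 -> 1 <= nm lam -> s != 0 ->
  bnd nm (nm s / (4 * nm lam)) (w - s *: (delta_mx i0 0 +
    lam^-1 *: delta_mx i1 0)) ->
  exists2 v : 'rV[K]_n, v *m w = 0 &
    bnd nm 3 ((1%:M - w *m v) *m val (upper_left m t)).
Proof.
move=> tE b1 s0; have a0 : 0 < nm s by exact: absv_gt0.
have lam0 : lam != 0 by apply: (@absv_neq0 _ _ nm); lra.
have [a aE] : exists a, nm s = a by exists (nm s).
have [b bE] : exists b, nm lam = b by exists (nm lam).
rewrite aE bE in a0 b1 * => wB.
have b0 : 0 < b by lra.
have bn0 : b != 0 by rewrite gt_eqF.
have an0 : a != 0 by rewrite gt_eqF.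
have ab0 : 0 < a / b by rewrite divr_gt0.
have abE : a / (4 * b) = a / b / 4 by field.
have aab : a / b <= a by rewrite ler_pdivrMr// ler_peMr// ltW.
have ab : a / (4 * b) <= a / 4 by rewrite abE; lra.
have w0 : nm (w i0 0 - s) <= a / 4.
  have := wB i0 0; rewrite !mxE eqxx /= !mulr0 addr0 mulr1 => h;
    exact: le_trans ab.
have w1 : nm (w i1 0 - s / lam) <= a / b / 4.
  by have := wB i1 0; rewrite !mxE eqxx /= add0r mulr1 -abE.
have wj j : nm (w (rshift 2 j) 0) <= a / b / 4.
  by have := wB (rshift 2 j) 0; rewrite !mxE !eq_rlshift /= mulr0 addr0 mulr0
    subr0 -abE.
have w0b : 3 / 4 * a <= nm (w i0 0) <= 5 / 4 * a.
  have := absvD_ge nm s (w i0 0 - s); have := absvD nm s (w i0 0 - s).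
  by rewrite [s + _]addrC subrK aE => ? ?; apply/andP; split; lra.
have w1b : 3 / 4 * (a / b) <= nm (w i1 0) <= 5 / 4 * (a / b).
  have := absvD_ge nm (s / lam) (w i1 0 - s / lam).
  have := absvD nm (s / lam) (w i1 0 - s / lam).
  rewrite [s / lam + _]addrC subrK absvM absvV aE bE => ? ?.
  by apply/andP; split; lra.
case/andP: w0b => w0l w0u; case/andP: w1b => w1l w1u.
have nw0 : 0 < nm (w i0 0) by lra.
have nw1 : 0 < nm (w i1 0) by lra.
have w00 := absv_neq0 nw0; have w10 := absv_neq0 nw1.
have wi i : i != i0 -> nm (w i 0) <= 5 / 4 * (a / b).
  case: (split_ordP i) => k ->; last by move=> _; have := wj k; lra.
  by move: k; apply: ord2P => //; rewrite eqxx.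
have wa i : nm (w i 0) <= 5 / 4 * a.
  have [->//|/wi h] := eqVneq i i0; lra.
(* 1 - w v kills e_0 up to O(1/lam) and moves e_1 by O(lam). *)
pose v : 'rV[K]_n := (w i0 0)^-1 *: delta_mx 0 i0 - (w i1 0)^-1 *: delta_mx 0
  i1.
have v0 : v 0 i0 = (w i0 0)^-1 by rewrite !mxE eqxx /= mulr0 subr0 mulr1.
have v1 : v 0 i1 = - (w i1 0)^-1 by rewrite !mxE eqxx /= mulr0 sub0r mulr1.
have vj j : v 0 (rshift 2 j) = 0 by rewrite !mxE !eq_rlshift /= !mulr0 subr0.
exists v.
  rewrite mulmxBl -!scalemxAl -!rowE; apply/matrixP => i j.
  by rewrite !ord1 !mxE !mulVf// subrr.
set M := 1%:M - w *m v.
have ME i j : M i j = (i == j)%:R - w i 0 * v 0 j.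
  rewrite mxE; congr (_ + _); first by rewrite mxE.
  by rewrite mxE; congr (- _); rewrite mxE big_ord1.
move=> i; have [E0 E1 Ej] := mul_upper_left_diag M i tE.
move=> j; case: (split_ordP j) => k ->.
  move: k; apply: ord2P.
    rewrite E0 ME v0; have [->|ii0] := eqVneq i i0.
      by rewrite mulfV// subrr mulr0 absv0.
    rewrite sub0r mulrN absvN !absvM absvV bE mulrA ler_pdivrMr//.
    apply: (@le_trans _ _ (b * (5 / 4 * (a / b)))).
      by rewrite ler_wpM2l ?wi// ltW.
    rewrite [leLHS](_ : _ = 5 / 4 * a); last by field.
    lra.
  rewrite E1 ME v1 mulrN opprK absvM absvV bE mulrC ler_pdivrMr//.
  apply: le_trans (absvD _ _ _) _.
  have d1 : nm (i == i1)%:R <= 1 by case: (i == i1); rewrite ?absv1 ?absv0.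
  have : nm (w i 0 / w i1 0) <= 5 / 3 * b.
    rewrite absvM absvV ler_pdivrMr//; apply: le_trans (wa i) _.
    apply: (@le_trans _ _ (5 / 3 * b * (3 / 4 * (a / b)))).
      by rewrite [leRHS](_ : _ = 5 / 4 * a) //; field.
    by rewrite ler_wpM2l//; lra.
  lra.
rewrite Ej ME vj mulr0 subr0; apply: (@le_trans _ _ 1); last by rewrite ler1n.
by case: (i == _); rewrite ?absv1 ?absv0.
Qed.

Variables (cg N : R) (T : finType) (pt : T -> K).
Hypotheses (N0 : 0 < N) (cg0 : 0 < cg) (gT :
  fine_grid nm (absv_dim nm) cg N pt).

(** An affine chart of projective space. The value f k is ignored, so it contributes a free factor
    #|T| to the counts. Charts with k = 0, 1 suffice because the column that matters has a large
    entry among its top two. *)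
Definition grid_vector (rad : K) (k : 'I_2) (f : {ffun 'I_n -> T}) : 'cV[K]_n :=
  \col_i if i == lshift m k then 1 else rad * pt (f i).

(** All e in a ball around s z work. An error r on the grid becomes 1 / (8 n beta^2 |lam|) after
    scaling by rad, then at most 1 / (8 beta |lam|) after applying B^-1; as |s| >= 1 / (2 beta),
    this is the precision of [contracting_direction]. *)
Lemma card_transvections_ge (B C : G) (t : SL K 2) (lam rad : K) (beta sigma :
  R)
    (k : 'I_2) (r := (8 * n%:R * beta ^+ 2 * nm rad * nm lam)^-1) :
  val t = mx2 lam 0 0 lam^-1 -> 1 <= beta -> 16 * beta <= nm lam ->
  sized nm beta B -> bnd nm sigma (val C) ->
    8^-1 <= nm (val B (lshift m k) i0) ->
  nm rad = 32 * beta -> N^-1 <= r ->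
  #|T|%:R * ((r / cg) ^+ d * #|T|%:R) ^+ n.-1 <=
  #|[pred f | `[< exists2 u : G, is_transvection (grid_vector rad k f) u &
       bnd nm (n%:R * (n%:R * beta * 3) * sigma)
         (val (u^-1 * (B * upper_left m t * C))%g) >]]|%:R :> R.
Proof.
move=> tE beta1 lamb [Bb Bb'] Cs Bk radE Nr.
have lam0 : lam != 0 by apply: (@absv_neq0 _ _ nm); lra.
have n0 : 2 <= n%:R :> R by rewrite ler_nat leq_addr.
have [b bE] : exists b, nm lam = b by exists (nm lam).
rewrite /r bE radE in lamb Nr *.
have b0 : 0 < b by lra.
have b1 : 1 <= b by lra.
have bn0 : b != 0 by rewrite gt_eqF.
have beta0 : 0 < beta by lra.
have beta32 : 1 <= 32 * beta by lra.
have n8 : 1 <= 8 * n%:R :> R by lra.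
have b0W := ltW beta0.
have betan0 : beta != 0 by rewrite gt_eqF.
have nn0 : n%:R != 0 :> R by rewrite gt_eqF//; lra.
pose q := delta_mx i0 0 + lam^-1 *: delta_mx i1 0 : 'cV[K]_n.
pose z := val B *m q.
have zE i : z i 0 = val B i i0 + val B i i1 / lam.
  by rewrite /z mulmxDr -scalemxAr -!colE !mxE mulrC.
have zb i : nm (z i 0) <= beta + 1.
  rewrite zE (le_trans (absvD _ _ _))// lerD// absvM absvV bE ler_pdivrMr//
    mul1r.
  by apply: le_trans (Bb _ _) _; lra.
have zk : 16^-1 <= nm (z (lshift m k) 0).
  rewrite zE; apply: le_trans (absvD_ge _ _ _); rewrite absvM absvV bE.
  have : nm (val B (lshift m k) i1) / b <= 16^-1.
    by rewrite ler_pdivrMr//; apply: le_trans (Bb _ _) _; lra.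
  by lra.
(* This scaling puts z in chart k. Since |s z_i| <= 16 (beta + 1) <= 32 beta = |rad|, the target
   lies in the part of the chart covered by the grid. *)
pose s := (z (lshift m k) 0)^-1.
have zk0 : z (lshift m k) 0 != 0 by apply: (@absv_neq0 _ _ nm); lra.
have s0 : s != 0 by rewrite invr_eq0.
have s16 : nm s <= 16.
  by rewrite absvV -[16]invrK lef_pV2 ?posrE ?invr_gt0 ?absv_gt0.
have sb : (2 * beta)^-1 <= nm s.
  rewrite absvV lef_pV2 ?posrE ?absv_gt0//; last by lra.
  by apply: le_trans (zb _) _; lra.
have rad0 : rad != 0 by apply: (@absv_neq0 _ _ nm); rewrite radE; lra.
pose P (i : 'I_n) : pred T := fun t => (i == lshift m k) ||
  (nm (pt t - s * z i 0 / rad) <= (8 * n%:R * beta ^+ 2 * (32 * beta) * b)^-1).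
have [_ _ H] := gT.
have q0 : 0 <= ((8 * n%:R * beta ^+ 2 * (32 * beta) * b)^-1 / cg) ^+ d *
  #|T|%:R.
  rewrite mulr_ge0// exprn_ge0// divr_ge0 ?(ltW cg0)//.
  by rewrite (le_trans _ Nr)// invr_ge0 ltW.
have r1 : (8 * n%:R * beta ^+ 2 * (32 * beta) * b)^-1 <= 1.
  have x1 : 1 <= 8 * n%:R * beta ^+ 2 * (32 * beta) * b.
    do 3!apply: mulr_ege1 => //; exact: exprn_ege1.
  by rewrite invf_le1// (lt_le_trans _ x1).
apply: (@le_trans _ _ (#|[pred f : {ffun 'I_n -> T} | [forall i,
  P i (f i)]]|%:R)).
  rewrite -[X in _ ^+ X.-1](card_ord n).
  apply: (@card_ffun_forall_ge _ _ _ _ (lshift m k)) => // [i ik|u];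
    last by rewrite /P eqxx.
  have [_ HH] := H (s * z i 0 / rad) _ Nr.
  rewrite (@eq_card _ _ [pred t | nm (pt t - s * z i 0 / rad) <= (8 * n%:R *
    beta ^+ 2 * (32 * beta) * b)^-1]).
    apply: HH => //; rewrite !absvM absvV radE ler_pdivrMr; last by lra.
    apply: (@le_trans _ _ (16 * (beta + 1))); last by lra.
    by rewrite ler_pM ?absv_ge0.
  by move=> u; rewrite !inE /P unfold_in (negbTE ik).
rewrite ler_nat; apply/subset_leq_card/fintype.subsetP => f;
  rewrite !inE => /forallP fP.
apply/asboolP; pose e := grid_vector rad k f.
have eE : bnd nm (8 * n%:R * beta ^+ 2 * b)^-1 (e - s *: z).
  move=> i j; rewrite ord1 {j}.
  have -> : (e - s *: z) i 0 = e i 0 - s * z i 0.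
    by rewrite mxE; congr (_ + _); rewrite mxE; congr (- _); rewrite mxE.
  rewrite [e i 0]mxE; case: eqVneq => [->|ik].
    by rewrite mulVf// subrr absv0 invr_ge0 !mulr_ge0// ltW.
  have := fP i; rewrite /P (negbTE ik) /= => h.
  rewrite [X in nm X](_ : _ = rad * (pt (f i) - s * z i 0 / rad));
    last by field.
  rewrite absvM radE; apply: le_trans (ler_wpM2l _ h) _;
    first by rewrite mulr_ge0.
  rewrite le_eqVlt; apply/orP; left; apply/eqP.
  by move: (n%:R : R) nn0 => x x0; field; rewrite betan0 x0 bn0.
pose w := val B^-1%g *m e.
have wB : bnd nm (nm s / (4 * nm lam)) (w - s *: q).
  have -> : w - s *: q = val B^-1%g *m (e - s *: z).
    rewrite mulmxBr /z -scalemxAr mulmxA [_ *m val B]mulVmx ?SL_unit// mul1mx.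
    by [].
  apply: bnd_le (bndM b0W Bb' eE).
  rewrite [leLHS](_ : _ = (2 * beta)^-1 / (4 * b)); last first.
    by move: (n%:R : R) nn0 => x x0; field; rewrite betan0 x0 bn0.
  by rewrite bE ler_wpM2r// invr_ge0 mulr_ge0// ltW.
have lam1 : 1 <= nm lam by rewrite bE.
have [v vw0 vb] := contracting_direction tE lam1 s0 wB.
have ve : (v *m val B^-1%g) *m e = 0 by rewrite -mulmxA.
have [u uE uVE] := transvection_exists ve.
(* Here u is the conjugate by B of 1 + w v, so u^-1 B t C = B ((1 - w v) t) C is a product of
   bounded factors. *)
apply/asboolP; exists u; first by exists (v *m val B^-1%g).
have -> : val (u^-1 * (B * upper_left m t * C))%g =
  val B *m ((1%:M - w *m v) *m val (upper_left m t)) *m val C.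
  transitivity (val u^-1%g *m (val B *m val (upper_left m t) *m val C)) => //.
  rewrite uVE !mulmxA; congr (_ *m _ *m _).
  rewrite mulmxBl mul1mx mulmxBr mulmx1 !mulmxA.
  rewrite [val B *m _]mulmxV ?SL_unit// mul1mx -!mulmxA.
  by rewrite [val B^-1%g *m val B]mulVmx ?SL_unit// mulmx1.
apply: bndM => //; last exact: bndM.
by rewrite !mulr_ge0.
Qed.

End TransvectionCount.

(** * Comparison of the two counts *)

Section Comparison.
Variables (R : realType) (K : numFieldType) (nm : absval R K) (m : nat).
Local Notation n := (2 + m)%N.
Local Notation G := (SL K n).
Local Notation H := (@SL2_upper_left K n).
Local Notation d := (absv_dim nm).

(** Grid points have absolute value at most 2, so eta gives entries of size at most 1 / (4n), as
    [sized_unipotent] requires. *)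
Let eta : K := (8 * n)%:R^-1.
Let rad : K := (32 * (4 * n))%:R.

Lemma absv_eta : nm eta = (8 * n%:R)^-1.
Proof. by rewrite absvV absv_nat natrM. Qed.

Lemma absv_rad : nm rad = 32 * (4 * n%:R).
Proof. by rewrite absv_nat !natrM. Qed.

Definition grid_unipotent (T : finType) (pt : T -> K)
    (th : {ffun 'I_m -> T * T} * {ffun 'I_m -> T * T}) : G :=
  unipotent (grid_mx pt eta th.1) (grid_mx pt eta th.2)^T.

Definition meets_orbit R0 (T : finType) (pt : T -> K) (g : G)
    (th : {ffun 'I_m -> T * T} * {ffun 'I_m -> T * T}) : bool :=
  `[< exists h c, [/\ H h, sized nm R0 c & g = (grid_unipotent pt th * h *
    c)%g] >].

Definition near_transvection r (T : finType) (pt : T -> K) (g : G)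
    (z : 'I_2 * {ffun 'I_n -> T}) : bool :=
  `[< exists2 u : G, is_transvection (grid_vector pt rad z.1 z.2) u &
        bnd nm r (val (u^-1 * g)%g) >].

Lemma sized_grid_unipotent cg N (T : finType) (pt : T -> K) th :
  fine_grid nm (absv_dim nm) cg N pt -> sized nm 2 (grid_unipotent pt th).
Proof.
move=> gT; apply: sized_unipotent; first exact: (bnd_grid_mx gT _ absv_eta).
by move=> i j; rewrite mxE; exact: (bnd_grid_mx gT _ absv_eta).
Qed.

Lemma sized_grid_unipotentM cg N (T : finType) (pt : T -> K) th (l : SL K 2) :
  fine_grid nm (absv_dim nm) cg N pt -> sized nm 2 l ->
  sized nm (4 * n%:R) (grid_unipotent pt th * upper_left m l)%g.
Proof.
move=> gT ls; rewrite (_ : 4 * n%:R = n%:R * 2 * 2);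
  last by rewrite mulrC -mulrA -natrM.
apply: sizedM => //; [exact: sized_grid_unipotent gT|].
by apply: sized_upper_left => //; lra.
Qed.

Lemma bnd_grid_vector cg N (T : finType) (pt : T -> K) z :
  fine_grid nm (absv_dim nm) cg N pt -> bnd nm (2 * (32 * (4 * n%:R)))
    (grid_vector pt rad z.1 z.2 : 'cV[K]_n).
Proof.
move=> [_ pt2 _] i j; rewrite mxE; have n1 : 1 <= n%:R :> R by rewrite ler1n.
case: ifP => _; first by rewrite absv1; lra.
by rewrite absvM absv_rad mulrC ler_wpM2r// ; lra.
Qed.

Section Decomposition.
Variables (R0 : R) (R01 : 1 <= R0).
(** In a decomposition g = y l t C, [beta] bounds y l and [sigma] bounds C; [rho] bounds c C^-1 when
    two decompositions of g are compared, and [r'] is the resulting distance from g to U_e. *)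
Let beta : R := 4 * n%:R.
Let sigma : R := n%:R * 2 * R0.
Let rho : R := n%:R * R0 * sigma.
Let r' : R := n%:R * (n%:R * beta * 3) * sigma.

Lemma orbit_decomposition cg N (T : finType) (pt : T -> K) (g : G) th :
  (2 <= m)%N -> fine_grid nm (absv_dim nm) cg N pt -> meets_orbit R0 pt g th ->
  exists (l t : SL K 2) (lam : K) (C : G),
    [/\ val t = mx2 lam 0 0 lam^-1, 2^-1 <= nm lam, sized nm 2 l,
      sized nm sigma C &
        g = (grid_unipotent pt th * upper_left m l * upper_left m t * C)%g].
Proof.
move=> m2 gT /asboolP[h [c [/SL2_upper_leftE[A ->] cs ->]]].
have [l [t [r [lam [-> tE lam2 ls rs]]]]] := SL2_pivot nm A.
exists l, t, lam, (upper_left m r * c)%g; split=> //.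
  by apply: sizedM => //; [exact: le_trans ler01 R01|apply: sized_upper_left =>
    //; lra].
by rewrite !upper_leftM !mulgA.
Qed.

(** One parameter [th0] met by g serves as base point: any other one gives a second decomposition of
    g, and comparing the two yields the affine conditions. *)
Lemma card_meets_orbit_le cg N (T : finType) (pt : T -> K) (g C : G) th0
    (l t : SL K 2) (lam : K) :
  (2 <= m)%N -> 0 < N -> 0 < cg -> fine_grid nm (absv_dim nm) cg N pt ->
  val t = mx2 lam 0 0 lam^-1 -> 2^-1 <= nm lam -> sized nm 2 l ->
    sized nm sigma C ->
  g = (grid_unipotent pt th0 * upper_left m l * upper_left m t * C)%g ->
  N^-1 <= 8 * rho / (nm eta * nm lam) ->
  #|meets_orbit R0 pt g|%:R <=
    ((cg * (8 * rho / (nm eta * nm lam))) ^+ d) ^+ (2 * m) * #|T|%:R ^+ (4 *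
      m) :> R.
Proof.
move=> m2 N0 cg0 gT tE lam2 ls Cs gE Nr.
have lam0 : lam != 0 by apply: (@absv_neq0 _ _ nm); lra.
have Xb th : bnd nm (4 * n%:R)^-1 (grid_mx pt eta th : 'M[K]_(m, 2)).
  exact: (bnd_grid_mx gT _ absv_eta).
have Yb th : bnd nm (4 * n%:R)^-1 (grid_mx pt eta th : 'M[K]_(m, 2))^T.
  by move=> i j; rewrite mxE; exact: Xb.
have := card_unipotent_conditions N0 cg0 gT m2 lam0 absv_eta Nr (Xb th0.1) (Yb
  th0.2) ls.
apply: le_trans; rewrite ler_nat; apply/subset_leq_card/fintype.subsetP => th.
rewrite unfold_in => /asboolP[h [c [/SL2_upper_leftE[A ->] cs gE']]].
have R00 : 0 <= R0 by exact: le_trans ler01 R01.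
have s0 : 0 <= sigma by rewrite !mulr_ge0.
have [cC1 cC2] := sizedM R00 s0 cs (sizedV Cs).
rewrite invgM invgK in cC2.
rewrite gE' in gE.
have [c1 c2] := unipotent_conditions lam0 tE gE cC1 cC2.
by rewrite inE; apply/andP; split; apply/forallP.
Qed.

Lemma card_near_transvection_ge cg N (T : finType) (pt : T -> K) (g C : G) th0
    (l t : SL K 2) (lam : K) (r := (8 * n%:R * beta ^+ 2 * nm rad *
      nm lam)^-1) :
  (2 <= m)%N -> 0 < N -> 0 < cg -> fine_grid nm (absv_dim nm) cg N pt ->
  val t = mx2 lam 0 0 lam^-1 -> 16 * beta <= nm lam -> sized nm 2 l ->
    sized nm sigma C ->
  g = (grid_unipotent pt th0 * upper_left m l * upper_left m t * C)%g ->
  N^-1 <= r ->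
  #|T|%:R * ((r / cg) ^+ d * #|T|%:R) ^+ n.-1 <=
    #|near_transvection r' pt g|%:R :> R.
Proof.
move=> m2 N0 cg0 gT tE lamb ls Cs gE Nr.
have n1 : 1 <= n%:R :> R by rewrite ler1n.
set B := (grid_unipotent pt th0 * upper_left m l)%g in gE.
have Bs : sized nm beta B by exact: sized_grid_unipotentM gT ls.
have Xb th : bnd nm (4 * n%:R)^-1 (grid_mx pt eta th : 'M[K]_(m, 2)).
  exact: (bnd_grid_mx gT _ absv_eta).
have e0 : 0 <= (4 * n%:R)^-1 :> R by rewrite invr_ge0 mulr_ge0.
have [k kB] : exists k, 8^-1 <= nm (val B (lshift m k) (lshift m 0)).
  have Yb : bnd nm ((4 * n%:R)^-1 + (4 * n%:R)^-1) (grid_mx pt eta th0.2 :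
    'M[K]_(m, 2))^T.
    by move=> i j; rewrite mxE; apply: le_trans (Xb _ _ _) _; rewrite lerDl.
  have [k kl] := perturbed_col_ge m2 (Xb th0.1) Yb ls.1.
  exists k; apply: le_trans kl _; rewrite le_eqVlt; apply/orP; left; apply/eqP.
  apply: (congr1 (absv nm)); have -> : val B = val (grid_unipotent pt th0) *m
    val (upper_left m l) by [].
  rewrite val_unipotent val_upper_left mulmx_block block_mxEul.
  by rewrite mulmx0 addr0.
have beta1 : 1 <= beta by rewrite /beta; lra.
have := card_transvections_ge N0 cg0 gT tE beta1 lamb Bs Cs.1 kB absv_rad Nr.
move=> h; apply: le_trans h _; rewrite ler_nat.
have kinj : injective (fun f : {ffun 'I_n -> T} => (k, f)) by move=> f f' [].
rewrite -(fintype.card_image kinj); apply/subset_leq_card/fintype.subsetP => z.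
case/mapP => f; rewrite mem_enum inE => fP ->;
  rewrite unfold_in /near_transvection gE.
exact/asboolP.
Qed.

(** The gap between the exponents only needs |lam| large, hence g outside a ball depending on eps.
    The grid must resolve the scale 1 / |lam|, so [N1] depends in addition on the upper bound kappa
    for g. *)
Lemma card_meets_orbit_near_transvection cg eps :
  (2 <= m)%N -> 0 < cg -> 0 < eps -> exists Tx, forall kappa, exists N1,
    forall N (T : finType) (pt : T -> K) (g : G),
    0 < N -> N1 <= N -> fine_grid nm (absv_dim nm) cg N pt ->
    ~ bnd nm Tx (val g) -> sized nm kappa g ->
    #|meets_orbit R0 pt g|%:R * #|{: 'I_2 * {ffun 'I_n -> T}}|%:R <=
    eps * #|near_transvection r' pt g|%:R *
      #|{: {ffun 'I_m -> T * T} * {ffun 'I_m -> T * T}}|%:R :> R.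
Proof.
move=> m2 cg0 eps0.
have n1 : 1 <= n%:R :> R by rewrite ler1n.
have R00 : 0 < R0 by exact: lt_le_trans ltr01 R01.
have beta0 : 0 < beta by rewrite /beta; lra.
have sigma0 : 0 < sigma by rewrite !mulr_gt0//; lra.
have rho0 : 0 < rho by rewrite !mulr_gt0//; lra.
have eta0 : 0 < nm eta by rewrite absv_eta invr_gt0; lra.
have rad0 : 0 < nm rad by rewrite absv_rad; lra.
pose cE := 8 * rho / nm eta.
pose cD := (8 * n%:R * beta ^+ 2 * nm rad)^-1.
have cE0 : 0 < cE by rewrite divr_gt0// mulr_gt0.
have cD0 : 0 < cD by rewrite invr_gt0 !mulr_gt0//; lra.
have [Tb Tbgap] := @power_gap R (cg * cE) (cD / cg) eps d m (mulr_gt0 cg0 cE0)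
  (divr_gt0 cD0 cg0) eps0 (absv_dim_gt0 nm) m2.
(* [Tb] is for the gap, [16 * beta] for the lower count, and 2 dominates lam^-1. *)
pose Tl := Num.max Tb (Num.max (16 * beta) 2).
exists (n%:R * (n%:R * beta * Tl) * sigma) => kappa.
pose bmax := n%:R * (n%:R * beta * kappa) * sigma.
exists (bmax / cE + bmax / cD) => N T pt g N0 N1N gT gT' gk.
have D0 : 0 <= #|near_transvection r' pt g|%:R :> R by rewrite ler0n.
case: (pickP (meets_orbit R0 pt g)) => [th0 th0E|E0]; last first.
  by rewrite eq_card0// mul0r !mulr_ge0// ltW.
have [l [t [lam [C [tE lam2 ls Cs gE]]]]] := orbit_decomposition m2 gT th0E.
have Bs := sized_grid_unipotentM th0 gT ls.
have lamT : Tl <= nm lam.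
  rewrite leNgt; apply/negP => lt; apply: gT'; rewrite gE.
  have Tl2 : 2 <= Tl by rewrite !le_max lexx !orbT.
  have tT : bnd nm Tl (val (upper_left m t)).
    rewrite val_upper_left tE; apply: bnd_block.
    - apply: bnd_mx2; rewrite ?absv0 ?(ltW lt)//; [lra|lra|].
      apply: le_trans Tl2; rewrite absvV -[2]invrK lef_pV2 ?posrE//; lra.
    - by move=> i j; rewrite mxE absv0; lra.
    - by move=> i j; rewrite mxE absv0; lra.
    - by apply: bnd_le (@bnd1 _ _ nm m); lra.
  apply: bndM => //; last 1 first.
  - by case: Cs.
  - by rewrite !mulr_ge0//; lra.
  by apply: bndM => //; [exact: ltW|case: Bs].
(* lam is an entry of t = (y l)^-1 g C^-1, a product of bounded factors. *)
have lamM : nm lam <= bmax.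
  have k0 : 0 <= kappa by exact: sized_ge0 gk.
  have -> : lam = val (upper_left m t) (lshift m 0) (lshift m 0).
    by rewrite val_upper_left block_mxEul tE mxE.
  have -> : (upper_left m t = (grid_unipotent pt th0 * upper_left m l)^-1 * g *
    C^-1)%g.
    by rewrite gE mulgA mulgK mulKg.
  suff h : bnd nm bmax (val ((grid_unipotent pt th0 * upper_left m l)^-1 * g *
    C^-1)%g) by [].
  apply: bndM; [|apply: bndM|]; [| |by case: Bs|by case: gk|by case: Cs].
  - by rewrite !mulr_ge0// ltW.
  - exact: ltW.
have nlam0 : 0 < nm lam by lra.
have fine c : 0 < c -> bmax / c <= N -> N^-1 <= c / nm lam.
  move=> c0 bN; rewrite -[leRHS]invf_div lef_pV2 ?posrE ?divr_gt0//.
  by apply: le_trans bN; rewrite ler_pM2r ?invr_gt0.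
have bmax0 : 0 <= bmax by exact: le_trans (ltW nlam0) lamM.
have rE : 8 * rho / (nm eta * nm lam) = cE / nm lam by rewrite invfM mulrA.
have rD : (8 * n%:R * beta ^+ 2 * nm rad * nm lam)^-1 =
  cD / nm lam by rewrite invfM.
have NE : N^-1 <= 8 * rho / (nm eta * nm lam).
  by rewrite rE fine// (le_trans _ N1N)// lerDl divr_ge0// ltW.
have ND : N^-1 <= (8 * n%:R * beta ^+ 2 * nm rad * nm lam)^-1.
  by rewrite rD fine// (le_trans _ N1N)// lerDr divr_ge0// ltW.
have hE := card_meets_orbit_le m2 N0 cg0 gT tE lam2 ls Cs gE NE.
have lam16 : 16 * beta <= nm lam.
  by apply: le_trans lamT; rewrite !le_max lexx orbT.
have hD := card_near_transvection_ge m2 N0 cg0 gT tE lam16 ls Cs gE ND.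
have hG : 2 * ((cg * cE / nm lam) ^+ d) ^+ (2 * m) <= eps *
  ((cD / cg / nm lam) ^+ d) ^+ m.+1.
  by apply: Tbgap nlam0; apply: le_trans lamT; rewrite le_max lexx.
rewrite rE mulrA in hE; rewrite rD mulrAC exprMn in hD.
rewrite !card_prod !card_ffun !card_prod !card_ord.
set t0 : R := #|T|%:R in hE hD *.
have t00 : 0 <= t0 by rewrite ler0n.
rewrite (_ : n.-1 = m.+1)// in hD.
have -> : (2 * #|T| ^ n)%:R = 2 * t0 ^+ n :> R by rewrite natrM natrX.
have -> : ((#|T| * #|T|) ^ m * (#|T| * #|T|) ^ m)%:R = t0 ^+ (4 * m) :> R.
  by rewrite -expnD natrX natrM -/t0 -expr2 -exprM addnn -mul2n mulnA.
move: (((cg * cE / nm lam) ^+ d) ^+ (2 * m)) hE hG => P hE hG.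
move: (((cD / cg / nm lam) ^+ d) ^+ m.+1) hD hG => Q hD hG.
have S0 : 0 <= t0 ^+ (4 * m) by exact: exprn_ge0.
have U0 : 0 <= t0 ^+ n by exact: exprn_ge0.
have tU : t0 * (Q * t0 ^+ m.+1) = Q * t0 ^+ n by rewrite mulrCA -exprS.
rewrite {}tU in hD.
move: (t0 ^+ (4 * m)) (t0 ^+ n) S0 U0 hE hD => S U S0 U0 hE hD.
apply: (@le_trans _ _ (P * S * (2 * U))); first by rewrite ler_wpM2r// mulr_ge0.
have -> : P * S * (2 * U) = 2 * P * (S * U) by rewrite mulrACA [P * 2]mulrC.
apply: (@le_trans _ _ (eps * Q * (S * U))); first by rewrite ler_wpM2r//
  mulr_ge0.
have -> : eps * Q * (S * U) = eps * (Q * U) * S by rewrite [S * U]mulrC !mulrA.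
by rewrite ler_wpM2r// ler_wpM2l// ltW.
Qed.

End Decomposition.
End Comparison.

(** * Nonexistence of compact quotients *)

Section NoCompactQuotient.
Variables (R : realType) (K : numFieldType) (nm : absval R K) (m : nat).
Local Notation n := (2 + m)%N.
Local Notation G := (SL K n).
Local Notation H := (@SL2_upper_left K n).

Lemma bnd_nat (M : 'M[K]_n) : exists k : nat, forall i j, nm (M i j) < k%:R.
Proof.
exists (Num.truncn (\sum_i \sum_j nm (M i j))).+1 => i j.
apply: le_lt_trans (truncnS_gt _).
rewrite (bigD1 i)//= (bigD1 j)//= -addrA lerDl addr_ge0 ?sumr_ge0// => *.
  exact: absv_ge0.
by apply: sumr_ge0 => *; exact: absv_ge0.
Qed.

Lemma finite_set_bnd (A : set G) : finite_set A ->
  exists r, forall g, A g -> bnd nm r (val g).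
Proof.
case/finite_seqP => s ->; elim: s => [|g s [r IH]]; first by exists 0 => ? /=.
have [k gk] := bnd_nat (val g); exists (Num.max k%:R r) => h /=.
rewrite inE => /predU1P[->|/IH hr].
  by move=> i j; rewrite le_max (ltW (gk i j)).
by move=> i j; rewrite le_max hr orbT.
Qed.

Variable Gamma : set G.
Hypothesis gGamma : group_closed [in Gamma].
Hypothesis pd : properly_discontinuous H Gamma.

Let gH := @group_closed_SL2_upper_left K m.

Lemma proper_bnd_finite r : finite_set [set g | Gamma g /\
  exists b c h : G, [/\ bnd nm r (val b), bnd nm r (val c), H h
    & (g * c = b * h)%g]].
Proof.
have h := properly_discontinuous_finite gH pd (@compact_bnd _ _ nm n r).
apply: sub_finite_set h => g [Gg [b [c [h0 [? ? ? ?]]]]]; split=> //.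
by exists b, c, h0.
Qed.

(** The case c = h = 1 of the preceding finiteness. *)
Lemma lattice_bnd_finite r : finite_set [set g | Gamma g /\ bnd nm r (val g)].
Proof.
apply: sub_finite_set (proper_bnd_finite (Num.max r 1)) => g [Gg gr];
  split=> //.
exists g, 1%g, 1%g; split=> //.
- by apply: bnd_le gr; rewrite le_max lexx.
- by apply: bnd_le (@bnd1 _ _ nm n); rewrite le_max lexx orbT.
- exact: set_group1 gH.
Qed.

(** Otherwise every x is boundedly close to Gamma. For x in H the nearby g would then belong to a
    finite set by proper discontinuity, which bounds x, whereas H contains the transvections 1 + k
    E_01 with k arbitrarily large. *)
Lemma far_point r : exists x : G, forall g, Gamma g ->
  ~ bnd nm r (val (x^-1 * g)%g).
Proof.
apply: contrapT => /forallNP far.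
have near x : exists2 g, Gamma g & bnd nm r (val (x^-1 * g)%g).
  have /existsNP[g /not_implyP[Gg /contrapT xg]] := far x.
  by exists g.
pose r1 := r + n.-1`!%:R * r ^+ n.-1.
have [B BP] := finite_set_bnd (proper_bnd_finite (Num.max r1 1)).
pose B1 := B + n.-1`!%:R * B ^+ n.-1.
have [k kB] : exists k : nat, n%:R * B1 * r1 < k%:R.
  by exists (Num.truncn (n%:R * B1 * r1)).+1; exact: truncnS_gt.
have te : (k%:R *: delta_mx 0 (lshift m 1) :
  'rV[K]_n) *m (delta_mx (lshift m 0) 0 : 'cV[K]_n) = 0.
  by rewrite -scalemxAl mul_delta_mx_0// scaler0.
have [x xE _] := transvection_exists te.
have Hx : H x by exact: elementary_transvection xE.
have [g Gg xg] := near x.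
have [s1 s2] := bnd_sized xg.
(* g^-1 = (x^-1 g)^-1 x^-1, with a bounded left factor and x^-1 in H. *)
have gB : bnd nm B (val g^-1%g).
  apply: BP; split; first exact: set_groupV.
  exists (x^-1 * g)^-1%g, 1%g, x^-1%g; split.
  - by apply: bnd_le s2; rewrite le_max lexx.
  - by apply: bnd_le (@bnd1 _ _ nm n); rewrite le_max lexx orbT.
  - exact: set_groupV gH Hx.
  - by rewrite mulg1 invgM invgK mulgK.
have [_] := bnd_sized gB; rewrite invgK => g1.
have B10 : 0 <= B1 by apply: le_trans (absv_ge0 nm (val g 0 0)) (g1 0 0).
have : bnd nm (n%:R * B1 * r1) (val x).
  rewrite (_ : x = g * (x^-1 * g)^-1)%g; last by rewrite invgM invgK mulVKg.
  exact: bndM g1 s2.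
move=> /(_ (lshift m 0) (lshift m 1)); rewrite xE -scalemxAr mul_delta_mx !mxE
  !eqxx.
rewrite eq_lshift /= add0r mulr1 absv_nat => le.
by move: (le_lt_trans le kB); rewrite ltxx.
Qed.

Hypothesis cpt : compact [set: orbit_space H Gamma].

Let O (k : nat) : set G := [set g : G | (forall i j, nm (val g i j) < k%:R) /\
  (forall i j, nm (val g^-1%g i j) < k%:R)].

Lemma cocompact_bound : exists k, forall y, exists g h, [/\ Gamma g, H h
  & O k (g * y * h)%g].
Proof.
apply: cocompact_exhaustion => //.
- by move=> k; exact: open_bnd_lt.
- move=> k l kl g [g1 g2]; split=> i j; apply: lt_le_trans (_ : k%:R <= l%:R);
  rewrite ?ler_nat//.
- move=> g; have [k gk] := bnd_nat (val g); have [l gl] := bnd_nat (val g^-1%g).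
  exists (maxn k l); split=> i j.
    by apply: lt_le_trans (gk i j) _; rewrite ler_nat leq_maxl.
  by apply: lt_le_trans (gl i j) _; rewrite ler_nat leq_maxr.
Qed.

(** [R0] is uniform in x, while B may depend on x. An element of Gamma that serves y also serves all
    nearby points, by openness, so compactness of the set of y bounds the elements needed. *)
Lemma cocompact_finite_bound : exists R0, 1 <= R0 /\ forall r (x : G),
  exists B, forall y : G,
  bnd nm r (val y) -> exists g h c : G,
  [/\ Gamma g, bnd nm B (val g), H h, sized nm R0 c & (x^-1 * g = y * h * c)%g].
Proof.
have [k0 k0P] := cocompact_bound.
exists (k0%:R + 1); split; first by rewrite lerDr.
move=> r x; have /compact_near_coveringP cp := @compact_bnd _ _ nm n r.
pose P (k : nat) (y : G) := exists g h : G, [/\ Gamma g, bnd nm k%:R (val g),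
  H h & O k0 (g^-1 * x * y * h)%g].
have [|k _ /(_ k (leqnn k)) kP] := cp nat \oo P _ _.
  move=> y _; have [g [h [Gg Hh Oy]]] := k0P (x * y)%g.
  have [k gk] := bnd_nat (val g^-1%g).
  exists ([set z | O k0 (g * x * z * h)%g], [set l | (k <= l)%N]).
    split; last by exists k.
    apply: (@translation_continuous G (g * x)%g h y (O k0));
      apply: open_nbhs_nbhs; split; first exact: open_bnd_lt.
    by move: Oy; rewrite !mulgA.
  case=> z l /= [Oz kl]; exists g^-1%g, h; split=> //.
  - exact: set_groupV.
  - by move=> i j; apply: le_trans (ltW (gk i j)) _; rewrite ler_nat.
  - by rewrite invgK.
exists k%:R => y /kP[g [h [Gg gk Hh Oz]]]; case: Oz => o1 o2.
exists g, h, (g^-1 * x * y * h)^-1%g; split=> //.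
- apply: sizedV; split=> i j; apply: le_trans (_ : k0%:R <= _);
  rewrite ?lerDl// ltW//.
- by rewrite !invgM invgK !mulgA mulgK mulgV mul1g.
Qed.

(** Write g_i = x u_i a_i with a_i bounded. In g_1^-1 g_2 the factor x cancels, and u_1^-1 u_2 = b h
    b^-1 lies in U_e, whence (g_1^-1 g_2)(a_2^-1 b) = (a_1^-1 b) h. So g_1^-1 g_2 belongs to a
    finite set independent of x and e, whose size gives M. *)
Lemma card_transvection_le r rE : exists M : nat,
  forall (x : G) (e : 'cV[K]_n) (k : 'I_2) (s : seq G),
  e (lshift m k) 0 = 1 -> bnd nm rE e -> uniq s ->
  (forall g, g \in s -> Gamma g /\
    exists2 u : G, is_transvection e u & bnd nm r (val (u^-1 * (x^-1 * g))%g))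
      ->
  (size s <= M)%N.
Proof.
have [r' thinP] := transvection_thin nm m rE.
pose r1 := r + n.-1`!%:R * r ^+ n.-1.
have /finite_seqP[l lE] := proper_bnd_finite (n%:R * r1 * r').
exists (size l) => x e k [//|g1 s] ek er us sP.
have [G1 [u1 u1e /bnd_sized u1r]] := sP g1 (mem_head _ _).
rewrite -(size_map (fun g => g1^-1 * g)%g); apply: uniq_leq_size.
  by rewrite map_inj_uniq//; exact: mulgI.
move=> _ /mapP[g2 g2s ->].
have [G2 [u2 u2e /bnd_sized u2r]] := sP g2 g2s.
have : [set` l] (g1^-1 * g2)%g; last by [].
rewrite -lE; split; first by apply: set_groupM => //; exact: set_groupV.
have [b [h [bs Hh E]]] := thinP k e _ ek er (is_transvectionVM u1e u2e).
set a1 := (u1^-1 * (x^-1 * g1))%g in u1r; set a2 := (u2^-1 * (x^-1 * g2))%g in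
  u2r.
have r10 : 0 <= r1 by exact: sized_ge0 u1r.
have r'0 : 0 <= r' by exact: sized_ge0 bs.
exists (a1^-1 * b)%g, (a2^-1 * b)%g, h; split=> //.
- by have [] := sizedM r10 r'0 (sizedV u1r) bs.
- by have [] := sizedM r10 r'0 (sizedV u2r) bs.
rewrite -[(a1^-1 * b * h)%g]mulgA.
have -> : (b * h = u1^-1 * u2 * b)%g by rewrite E mulgVK.
rewrite /a1 /a2 !invgM !invgK !mulgA.
by rewrite !mulgK.
Qed.

Lemma no_compact_orbit_space : (2 <= m)%N -> False.
Proof.
move=> m2; have [R0 [R01 cocpt]] := cocompact_finite_bound.
have [cg cg0 grid] := absv_grid nm.
pose r' : R := n%:R * (n%:R * (4 * n%:R) * 3) * (n%:R * 2 * R0).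
have [M MP] := card_transvection_le r' (2 * (32 * (4 * n%:R))).
(* Chosen so that eps M < 1, against the conclusion of [double_counting]. *)
pose eps : R := (M.+1%:R)^-1.
have eps0 : 0 < eps by rewrite invr_gt0 ltr0n.
have [Tx TxP] := card_meets_orbit_near_transvection nm R01 m2 cg0 eps0.
have [x xP] := far_point Tx.
(* 2 is the bound on the matrices y, uniform over all grids, so B and the list s can be fixed before
   the grid. *)
have [B BP] := cocpt 2 x.
have /finite_seqP[s sE] := lattice_bnd_finite B.
have sP g : g \in undup s -> Gamma g /\ bnd nm B (val g).
  by rewrite mem_undup => gs; have : [set` s] g by []; rewrite -sE.
have [kappa kP] : exists kappa, forall g, g \in undup s ->
  sized nm kappa (x^-1 * g)%g.
  have [k xk] := bnd_nat (val x^-1%g).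
  pose k1 : R := n%:R * k%:R * B.
  exists (k1 + n.-1`!%:R * k1 ^+ n.-1) => g /sP[_ gB].
  by apply: bnd_sized; apply: bndM => //= i j; exact: ltW.
have [N1 N1P] := TxP kappa.
pose N := Num.max N1 1.
have N0 : 0 < N by rewrite lt_max ltr01 orbT.
have [T [pt gT]] := grid N N0.
have : 1 <= eps * M%:R.
  apply: (@double_counting R G (undup s) _ _
    (fun g => meets_orbit nm R0 pt (x^-1 * g)%g)
    (fun g => near_transvection nm r' pt (x^-1 * g)%g) M%:R eps).
  - have [T0 _ _] := gT.
    by rewrite !card_prod !card_ffun !card_prod !card_ord !muln_gt0 !expn_gt0
      !muln_gt0 T0.
  - have [T0 _ _] := gT.
    by rewrite card_prod card_ffun !card_ord muln_gt0 expn_gt0 T0.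
  - exact: ltW.
  - move=> th; apply/hasP.
    have [g [h [c [Gg gB Hh cs E]]]] := BP _ (sized_grid_unipotent th gT).1.
    exists g; last by apply/asboolP; exists h, c.
    by rewrite mem_undup; have : [set` s] g by rewrite -sE.
  - move=> z; rewrite ler_nat -size_filter.
    apply: (MP x _ z.1 _ _ (bnd_grid_vector z gT)).
    + by rewrite mxE eqxx.
    + by rewrite filter_uniq// undup_uniq.
    + by move=> g; rewrite mem_filter => /andP[/asboolP ? /sP[]].
  - move=> g gs; have [Gg _] := sP g gs.
    apply: (N1P N) => //; [by rewrite /N le_max lexx|exact: xP|exact: kP].
by rewrite /eps mulrC ler_pdivlMr ?ltr0n// mul1r ler_nat ltnn.
Qed.

End NoCompactQuotient.

Theorem mainTheorem9 (R : realType) (n : nat) (hn : (4 <= n)%N) :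
  ~ admits_compact_quotient (@SL2_upper_left R n) /\
  ~ admits_compact_quotient (@SL2_upper_left R[i] n).
Proof.
case: n hn => [|[|m]] // m2.
split=> -[Gamma [[gG _] pd cpt]].
  exact: (no_compact_orbit_space (real_absval R) gG pd cpt).
exact: (no_compact_orbit_space (complex_absval R) gG pd cpt).
Qed.
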